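(* Let $K\in\mathbb{R}$, $N\in[1,\infty)$, and let $(X,d,\mathfrak{m})$ be a nonbranching $\mathrm{CD}^*(K,N)$ space with $\operatorname{supp}\mathfrak{m}=X$. (1) Let $p,q\in X$ with $p\neq q$, and put $E(p,q)=\{x\in X\mid d(p,x)=d(q,x)\}$. Then $\mathfrak{m}(E(p,q))=0$. (2) Let $\pi:(\bar X,\bar d,\bar{\mathfrak{m}},\bar x_0)\to(X,d,\mathfrak{m},x_0)$ be a normal covering with deck transformation group $G$, where $(\bar X,\bar d,\bar{\mathfrak{m}})$ is the lift of $(X,d,\mathfrak{m})$ and $\pi(\bar x_0)=x_0$. Then for every $r>0$, $$\#(D^G(\bar x_0,2r))\cdot\mathfrak{m}(B_r(x_0))\ \ge\ \bar{\mathfrak{m}}(B_r(\bar x_0)),$$ $$\#(D^G(\bar x_0,r))\cdot\mathfrak{m}(B_r(x_0))\ \le\ \bar{\mathfrak{m}}(B_{2r}(\bar x_0)).$$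
   Context: $\mathrm{CD}^*(K,N)$ (reduced curvature-dimension condition of Bacher–Sturm): $(X,d)$ is a complete separable metric space, $\mathfrak{m}$ is a locally finite Borel measure, and for any two probability measures $\mu_0=\rho_0\mathfrak{m}$, $\mu_1=\rho_1\mathfrak{m}$ with bounded support there are an optimal coupling $q$ of them (for the cost $d^2$) and a $W_2$-geodesic $\mu_t=\rho_t\mathfrak{m}$ of absolutely continuous measures with bounded support such that, for all $t\in[0,1]$ and $N'\ge N$, $\int\rho_t^{-1/N'}d\mu_t\ge\int[\sigma^{(1-t)}_{K,N'}(d(x_0,x_1))\rho_0(x_0)^{-1/N'}+\sigma^{(t)}_{K,N'}(d(x_0,x_1))\rho_1(x_1)^{-1/N'}]\,dq(x_0,x_1)$. Here $\sigma^{(t)}_{K,N}(\theta)=\infty$ if $K\theta^2\ge N\pi^2$ (with $K>0$); $=\sin(\sqrt{K/N}\,t\theta)/\sin(\sqrt{K/N}\,\theta)$ if $K>0$ and $K\theta^2<N\pi^2$; $=t$ if $K=0$; $=\sinh(\sqrt{-K/N}\,t\theta)/\sinh(\sqrt{-K/N}\,\theta)$ if $K<0$ (with value $t$ at $\theta=0$). Such a space with $\operatorname{supp}\mathfrak{m}=X$ is a proper geodesic space. A geodesic metric space $(X,d)$ is nonbranching if there are no four different points $x,y,z,w\in X$ with $d(x,z)=d(x,y)+d(y,z)$ and $d(x,w)=d(x,y)+d(y,w)$. The lift: $\bar X$ is connected, $\bar d$ is the length distance for which the length of a curve $\gamma$ in $\bar X$ is the length of $\pi\circ\gamma$, and $\bar{\mathfrak{m}}$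 is the Borel measure with $\bar{\mathfrak{m}}(E)=\mathfrak{m}(\pi(E))$ for every Borel $E\subset\bar X$ contained in an open set on which $\pi$ is an isometry onto its image; $G$ acts on $\bar X$ by measure-preserving isometries. $B_r(x)$ is the open metric ball of radius $r$ centered at $x$; $D^G(\bar x_0,r)=\{g\in G:\bar d(\bar x_0,g(\bar x_0))\le r\}$; $\#(A)$ is the number of elements of $A$. *)

(* Defs.v *)
From HB Require Import structures.
From mathcomp Require Import all_boot all_order all_algebra.
From mathcomp Require Import all_classical all_reals all_analysis.

Set Implicit Arguments.
Unset Strict Implicit.
Unset Printing Implicit Defensive.

Import Order.TTheory GRing.Theory Num.Theory.
Import numFieldNormedType.Exports.

Local Open Scope classical_set_scope.
Local Open Scope ring_scope.

(* The library's sigma-algebras live on pointed types, so metric spaces are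
   taken with a default point (that is, nonempty); the point plays no other
   role. *)
#[short(type="metricPType")]
HB.structure Definition PointedMetric (K : numDomainType) :=
  {M of Metric K M & Pointed M}.

Notation borel X := (g_sigma_algebraType (@open X)).

Section metric_notions.
Context {R : realType}.

Definition bounded_in (X : metricPType R) (A : set X) :=
  exists x (r : R), A `<=` ball x r.

Definition complete_space (X : metricPType R) :=
  forall F : set_system X, ProperFilter F -> cauchy F -> cvg F.

Definition separable_space (X : metricPType R) :=
  exists2 D : set X, countable D & dense D.

Definition geodesic_space (X : metricPType R) :=
  forall x y : X, exists gamma : R -> X,
    [/\ gamma 0 = x, gamma 1 = y &
        {in `[0, 1]%R &, forall s t,
          mdist (gamma s) (gamma t) = `|s - t| * mdist x y}].

(* Nonbranching is a property of geodesic metric spaces.  The last equation puts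
   z and w at the same distance beyond y: without it, any four consecutive
   points of a single geodesic would count as a branching. *)
Definition nonbranching (X : metricPType R) :=
  geodesic_space X /\
  ~ exists x y z w : X,
      [/\ uniq [:: x; y; z; w],
          mdist x z = mdist x y + mdist y z,
          mdist x w = mdist x y + mdist y w &
          mdist y z = mdist y w].

(* The metric-valued counterpart of [variation 0 1 gamma s]. *)
Definition curve_variation (X : metricPType R) (gamma : R -> X) (s : seq R) : R :=
  let F := gamma \o nth 1 (0 :: s) in
  \sum_(0 <= n < size s) mdist (F n) (F n.+1).

Definition curve_length (X : metricPType R) (gamma : R -> X) : \bar R :=
  ereal_sup [set (curve_variation gamma s)%:E | s in itv_partition 0 1].

Definition locally_finite (X : metricPType R)
    (m : {measure set (borel X) -> \bar R}) :=
  forall x : X, exists U : set X, [/\ open U, U x & (m U < +oo)%E].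

Definition measure_support (X : metricPType R)
    (m : {measure set (borel X) -> \bar R}) : set X :=
  [set x | forall U : set X, open U -> U x -> (0 < m U)%E].

End metric_notions.

Section optimal_transport.
Context {R : realType} {X : metricPType R}.

Definition coupling (mu nu : probability (borel X) R)
    (q : probability (borel X * borel X)%type R) :=
  forall A : set (borel X), measurable A ->
    q (A `*` [set: borel X]) = mu A /\ q ([set: borel X] `*` A) = nu A.

Definition transport_cost (q : probability (borel X * borel X)%type R) : \bar R :=
  (\int[q]_z ((mdist (z.1 : X) (z.2 : X)) ^+ 2)%:E)%E.

Definition optimal_coupling (mu nu : probability (borel X) R)
    (q : probability (borel X * borel X)%type R) :=
  coupling mu nu q /\
  forall q' : probability (borel X * borel X)%type R,
    coupling mu nu q' -> (transport_cost q <= transport_cost q')%E.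

Definition W2 (mu nu : probability (borel X) R) : \bar R :=
  sqrte (ereal_inf [set transport_cost q | q in coupling mu nu]).

Definition W2_geodesic (mu0 mu1 : probability (borel X) R)
    (mu : R -> probability (borel X) R) :=
  [/\ forall A : set (borel X), measurable A -> mu 0 A = mu0 A,
      forall A : set (borel X), measurable A -> mu 1 A = mu1 A &
      {in `[0, 1]%R &, forall s t,
        W2 (mu s) (mu t) = (`|s - t|%:E * W2 mu0 mu1)%E}].

Definition bounded_support (mu : probability (borel X) R) :=
  bounded_in (measure_support mu).

Definition density (m : {measure set (borel X) -> \bar R})
    (mu : probability (borel X) R) (rho : X -> R) :=
  [/\ measurable_fun [set: borel X] (rho : borel X -> R),
      (forall x, 0 <= rho x) &
      forall A : set (borel X), measurable A ->
        mu A = (\int[m]_(x in A) (rho x)%:E)%E].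

End optimal_transport.

Section curvature_dimension.
Context {R : realType}.

Definition sinh (x : R) : R := (expR x - expR (- x)) / 2.

(* sigma^{(t)}_{K,N}(theta); both quotients take their limit value t at theta = 0. *)
Definition sigma (K N t theta : R) : \bar R :=
  if (0 < K) && (N * pi ^+ 2 <= K * theta ^+ 2) then +oo%E
  else if (K == 0) || (theta == 0) then t%:E
  else if 0 < K then
    (sin (Num.sqrt (K / N) * t * theta) / sin (Num.sqrt (K / N) * theta))%:E
  else
    (sinh (Num.sqrt (- K / N) * t * theta) / sinh (Num.sqrt (- K / N) * theta))%:E.

(* [0 `^ (- N'^-1)] is 0 here, instead of +oo, but the densities vanish only on
   null sets of the measures against which their powers are integrated. *)
Definition CDstar (K N : R) (X : metricPType R)
    (m : {measure set (borel X) -> \bar R}) :=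
  [/\ complete_space X, separable_space X, locally_finite m &
  forall (mu0 mu1 : probability (borel X) R) (rho0 rho1 : X -> R),
    density m mu0 rho0 -> density m mu1 rho1 ->
    bounded_support mu0 -> bounded_support mu1 ->
    exists (q : probability (borel X * borel X)%type R)
           (mu : R -> probability (borel X) R) (rho : R -> X -> R),
      [/\ optimal_coupling mu0 mu1 q,
          W2_geodesic mu0 mu1 mu,
          {in `[0, 1]%R, forall t,
            density m (mu t) (rho t) /\ bounded_support (mu t)} &
          {in `[0, 1]%R, forall t, forall N' : R, N <= N' ->
            (\int[q]_z
               (sigma K N' (1 - t) (mdist (z.1 : X) (z.2 : X))
                  * (rho0 z.1 `^ (- N'^-1))%:E
                + sigma K N' t (mdist (z.1 : X) (z.2 : X))
                  * (rho1 z.2 `^ (- N'^-1))%:E)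
             <= \int[mu t]_x (rho t x `^ (- N'^-1))%:E)%E}]].

End curvature_dimension.

Section coverings.
Context {R : realType}.

Definition homeo_on (Y Z : metricPType R) (V : set Y) (U : set Z) (f : Y -> Z) :=
  [/\ set_bij V U f, {within V, continuous f} &
      exists2 g : Z -> Y, {within U, continuous g} & {in V, cancel f g}].

Definition evenly_covered (Y Z : metricPType R) (f : Y -> Z) (U : set Z) :=
  exists S : set (set Y),
    [/\ forall V, S V -> open V /\ homeo_on V U f,
        forall V W, S V -> S W -> V `&` W !=set0 -> V = W &
        f @^-1` U = \bigcup_(V in S) V].

Definition covering_map (Y Z : metricPType R) (f : Y -> Z) :=
  [/\ continuous f, set_surj [set: Y] [set: Z] f &
      forall z, exists U, [/\ open U, U z & evenly_covered f U]].

Definition deck (Y Z : metricPType R) (f : Y -> Z) : set (Y -> Y) :=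
  [set g | homeo_on [set: Y] [set: Y] g /\ f \o g = f].

Definition normal_covering (Y Z : metricPType R) (f : Y -> Z) :=
  covering_map f /\
  forall a b, f a = f b -> exists2 g, deck f g & g a = b.

Definition curves (Y : metricPType R) (a b : Y) : set (R -> Y) :=
  [set gamma : R -> Y |
    [/\ {within `[0 : R, 1 : R], continuous gamma}, gamma 0 = a & gamma 1 = b]].

Definition is_lift_dist (Y Z : metricPType R) (f : Y -> Z) :=
  forall a b : Y,
    (mdist a b)%:E = ereal_inf [set curve_length (f \o gamma) | gamma in curves a b].

Definition isometry_on (Y Z : metricPType R) (V : set Y) (f : Y -> Z) :=
  forall x y, V x -> V y -> mdist (f x) (f y) = mdist x y.

Definition is_lift_measure (Y Z : metricPType R) (f : Y -> Z)
    (m : {measure set (borel Z) -> \bar R})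
    (mY : {measure set (borel Y) -> \bar R}) :=
  forall V E : set Y, open V -> isometry_on V f ->
    (@measurable _ (borel Y)) E -> E `<=` V -> mY E = m (f @` E).

(* Y is a metric space from the start: its topology, with respect to which f is
   a covering and curves are continuous, is the one induced by the lifted
   distance. *)
Definition is_lift (Y Z : metricPType R) (f : Y -> Z)
    (m : {measure set (borel Z) -> \bar R})
    (mY : {measure set (borel Y) -> \bar R}) :=
  [/\ connected [set: Y], is_lift_dist f & is_lift_measure f m mY].

(* D^G(y0, r), for G the deck transformation group of f. *)
Definition deck_ball (Y Z : metricPType R) (f : Y -> Z) (y0 : Y) (r : R) :
    set (Y -> Y) :=
  [set g | deck f g /\ mdist y0 (g y0) <= r].

End coverings.

(* Main.v *)
Require Import Defs.
From HB Require Import structures.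
From mathcomp Require Import finmap.
From mathcomp Require Import all_boot all_order all_algebra.
From mathcomp Require Import ring lra.
From mathcomp Require Import all_classical all_reals all_analysis.
From mathcomp Require Import measurable_realfun.

Set Implicit Arguments.
Unset Strict Implicit.
Unset Printing Implicit Defensive.

Import Order.TTheory GRing.Theory Num.Theory.
Import numFieldNormedType.Exports.

Local Open Scope classical_set_scope.
Local Open Scope ring_scope.

(* (1) If the bisector E of p and q were charged, it would contain a compact set
   C of positive measure.  Transport the uniform measure of a small ball around p
   to that of C: at a time t close to 1 the W2-geodesic is carried by points S
   that almost realize the equality case of
   d(x, z)^2 <= d(x, y)^2 / t + d(y, z)^2 / (1 - t) with z in C.  These points lie
   near C, and they avoid C, because in the equality case a point y of E
   would be an interior point of a minimal geodesic from p to a point of E, and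
   the geodesics from p and from q would branch at y.  The curvature bound
   integrates to a Brunn-Minkowski inequality that bounds m S from below by a
   fixed multiple of m C as t tends to 1, whereas the neighbourhoods of C have
   measures tending to m C.

   (2) The covering is locally an isometry and geodesics of X lift, so that
   the ball of radius r around x0 is the image of the ball around xbar0 and has a
   Borel section F in the latter.  The translates of F by the deck
   transformations have the measure of the ball of x0, those by D(2r) cover the
   ball of radius r, and those by D(r) are disjoint inside the ball of radius
   2r. *)

(** The curvature bound only provides some W2-geodesic of measures, without saying along which
    curves of X the mass moves. Its concentration on S is therefore read off the costs alone:
    near-optimal plans from time 0 to t and from t to 1 are glued, and mass outside S at time t
    would push the cost of the glued plan below the infimum. This argument needs a defect kap that
    is uniform over C, which is why C is compact. The value of kap depends on t, and the ball around
    p has to be small compared with kap; the lower bound for m S survives these choices because its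
    constant depends only on K, N and a bound for the distances. In (2) the count and the measures
    of the balls may be infinite, so all estimates are made in the extended reals. The lifted
    measure is known only on sets where the covering is an isometry, and separability of the
    covering space has to be proved before countably many such sets are seen to suffice. *)

(** * Metric spaces and their Borel sets *)

Section metric_basics.
Context {R : realType} {X : metricPType R}.
Implicit Types (x y z : X) (A U : set X).

(* [metric_sym] and the like are stated over a realFieldType; these copies have
   the instances that [lra] recognizes over a realType. *)
Lemma mdistC x y : mdist x y = mdist y x.
Proof. exact: metric_sym. Qed.

Lemma mdistD x y z : mdist x z <= mdist x y + mdist y z.
Proof. exact: metric_triangle. Qed.

Lemma mdist0 x : mdist x x = 0.
Proof. exact: mdistxx. Qed.

Lemma mdist_pos x y : x <> y -> 0 < mdist x y.
Proof. by move/eqP; rewrite mdist_gt0. Qed.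

Lemma ball_mdist x (r : R) : ball x r = [set y | mdist x y < r].
Proof. exact: ballEmdist. Qed.

Lemma open_ball_metric x r : open (ball x r).
Proof.
rewrite openE => y; rewrite ball_mdist /= => xy.
rewrite /interior -nbhs_ballE; exists (r - mdist x y) => /=; first by rewrite subr_gt0.
move=> z; rewrite !ball_mdist /= => yz.
by rewrite (le_lt_trans (mdistD _ y _))// -ltrBrDl.
Qed.

Lemma nbhs_mdistP x A :
  nbhs x A <-> exists2 e : R, 0 < e & forall y, mdist x y < e -> A y.
Proof.
rewrite -nbhs_ballE; split => -[e e0 eA]; exists e => //.
  by move=> y xy; apply: eA; rewrite ball_mdist.
by move=> y; rewrite ball_mdist; apply: eA.
Qed.

Lemma mdist_dist_le x y z : `|mdist x y - mdist x z| <= mdist y z.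
Proof.
rewrite ler_norml; apply/andP; split.
  by rewrite lerNl opprB lerBlDr addrC mdistD.
by rewrite lerBlDr addrC (mdistC y z) mdistD.
Qed.

Lemma mdist_continuous : continuous (fun z : X * X => mdist z.1 z.2).
Proof.
move=> [x y]; apply/cvgrPdist_le => e e0 /=.
exists (ball x (e / 2), ball y (e / 2)) => /=.
  by split; apply: nbhsx_ballx; rewrite divr_gt0.
move=> [x' y'] /=; rewrite !ball_mdist /= => -[xx' yy'].
rewrite -(subrK (mdist x y') (mdist x y)) -addrA (le_trans (ler_normD _ _))//.
rewrite (splitr e) lerD//; first by rewrite (le_trans (mdist_dist_le _ _ _))// ltW.
rewrite (mdistC x) (mdistC x').
by rewrite (le_trans (mdist_dist_le _ _ _))// ltW.
Qed.

Lemma mdistr_continuous x : continuous (mdist x).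
Proof.
move=> y; apply: (@continuous_comp _ _ _ (fun y => (x, y))
  (fun z : X * X => mdist z.1 z.2)).
  by apply: cvg_pair => //; exact: cvg_cst.
exact: mdist_continuous.
Qed.

Lemma dense_seqP : separable_space X ->
  exists u : nat -> X, forall x (e : R), 0 < e -> exists n, mdist (u n) x < e.
Proof.
move=> [D cD dD].
have D0 : D !=set0.
  have [|x [_ Dx]] := dD setT _ openT; first by exists point.
  by exists x.
have /pfcard_geP[e|[f]] := cD; first by case: D0; rewrite e.
exists f => x e e0.
have [|y []] := dD (ball x e) _ (open_ball_metric x e).
  by exists x; apply: ballxx.
rewrite ball_mdist /= => xy Dy; have [n _ fn] := @surj _ _ _ _ f _ Dy.
by exists n; rewrite fn mdistC.
Qed.

Lemma borel_open U : open U -> @measurable _ (borel X) U.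
Proof. exact: sub_sigma_algebra. Qed.

Lemma borel_closed A : closed A -> @measurable _ (borel X) A.
Proof.
move=> /closed_openC/borel_open /(@measurableC _ (borel X)).
by rewrite setCK.
Qed.

Lemma measurable_fun_continuous_borel (f : X -> R) :
  continuous f -> measurable_fun [set: borel X] (f : borel X -> R).
Proof.
move=> cf; apply: (measurability _ (RGenOpens.measurableE R)).
move=> _ [_ [a [b ->]] <-]; rewrite setTI; apply: borel_open.
by apply: open_comp => // x _; exact: cf.
Qed.

(** Continuity alone does not give this, since the Borel sets of a product may exceed the product
    sigma-algebra. The dense sequence describes the sublevel sets by countably many conditions, each
    on a sum of functions of one coordinate. *)
Lemma measurable_mdist : separable_space X ->
  measurable_fun [set: borel X * borel X]
    (fun z : borel X * borel X => mdist (z.1 : X) (z.2 : X)).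
Proof.
move=> /dense_seqP[u du].
apply: (measurability _ (RGenOInfty.measurableE R)).
move=> _ [_ [c ->] <-]; rewrite setTI.
rewrite (_ : _ @^-1` _ = ~` [set z : X * X | mdist z.1 z.2 <= c]); last first.
  by apply/seteqP; split => z /=; rewrite in_itv /= andbT ltNge => /negP.
apply: measurableC.
rewrite (_ : [set _ | _] = \bigcap_(k : nat) \bigcup_n
    [set z : X * X | mdist (u n) z.1 + mdist (u n) z.2 < c + k.+1%:R^-1]); last first.
  apply/seteqP; split => [[x y] /= xyc k _|[x y] xyc /=].
    have [|n un] := du x (k.+1%:R^-1 / 2); first by rewrite divr_gt0// invr_gt0.
    exists n => //=; have := mdistD (u n) x y; move: un.
    by move: (k.+1%:R^-1) => e; lra.
  apply/ler_addgt0Pr => e e0; have [k _ ke] := near_infty_natSinv_lt (PosNum e0).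
  have [n _ /= un] := xyc k I; have /= := ke k (leqnn _).
  have := mdistD x (u n) y; move: un; rewrite (mdistC x (u n)).
  by move: (k.+1%:R^-1) => d; lra.
apply: bigcap_measurable => // k _; apply: bigcup_measurable => n _.
have mu : measurable_fun setT (fun x : borel X => mdist (u n) (x : X)).
  by apply: measurable_fun_continuous_borel; exact: mdistr_continuous.
rewrite -[X in measurable X]setTI.
have -> : [set z : X * X | mdist (u n) z.1 + mdist (u n) z.2 < c + k.+1%:R^-1] =
  (fun z : borel X * borel X => mdist (u n) (z.1 : X) + mdist (u n) (z.2 : X))
   @^-1` `]-oo, (c + k.+1%:R^-1)[ by apply/seteqP; split => z /=; rewrite in_itv.
apply: measurable_funD => //; apply: measurableT_comp mu _ => //.
Qed.

End metric_basics.

(** * Integrals under restriction and push-forward *)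

Section restricted_integral.
Context d (T : measurableType d) (R : realType).
Variables (mu : {measure set T -> \bar R}) (D : set T) (mD : measurable D).

Lemma ge0_integral_mrestr (f : T -> \bar R) :
  measurable_fun setT f -> (forall x, 0 <= f x)%E ->
  (\int[mrestr mu mD]_x f x = \int[mu]_(x in D) f x)%E.
Proof.
move=> mf f0; rewrite (ge0_negligible_integral (mu := mrestr mu mD) (N := ~` D))//.
- rewrite setDE setTI setCK; apply: eq_measure_integral => A mA /setIidl AD.
  by rewrite /= /mrestr AD.
- exact: measurableC.
- by rewrite /= /mrestr setICl measure0.
Qed.

End restricted_integral.

Lemma trivIset_setXr (T U : Type) (A : set T) (P : (set U)^nat) :
  trivIset setT P -> trivIset setT (fun i => A `*` P i).
Proof.
move=> /trivIsetP tP; apply/trivIsetP => i j _ _ ij.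
by rewrite -subset0 => -[x y] [[_ Pi] [_ Pj]]; have := tP i j I I ij;
  rewrite -subset0; apply; split; [exact: Pi|exact: Pj].
Qed.

Lemma trivIset_setXl (T U : Type) (A : set U) (P : (set T)^nat) :
  trivIset setT P -> trivIset setT (fun i => P i `*` A).
Proof.
move=> /trivIsetP tP; apply/trivIsetP => i j _ _ ij.
by rewrite -subset0 => -[x y] [[Pi _] [Pj _]]; have := tP i j I I ij;
  rewrite -subset0; apply; split; [exact: Pi|exact: Pj].
Qed.

Lemma eq_pushforward_integral d1 d2 d3 (T1 : measurableType d1)
    (T2 : measurableType d2) (T3 : measurableType d3) (R : realType)
    (m1 : {measure set T1 -> \bar R}) (m2 : {measure set T2 -> \bar R})
    (f1 : T1 -> T3) (f2 : T2 -> T3) (g : T3 -> \bar R) :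
  measurable_fun setT f1 -> measurable_fun setT f2 -> measurable_fun setT g ->
  (forall x, 0 <= g x)%E ->
  (forall A, measurable A -> m1 (f1 @^-1` A) = m2 (f2 @^-1` A)) ->
  (\int[m1]_x g (f1 x) = \int[m2]_x g (f2 x))%E.
Proof.
move=> mf1 mf2 mg g0 m12.
have := ge0_integral_pushforward mf1 m1 measurableT mg (fun x _ => g0 x).
have := ge0_integral_pushforward mf2 m2 measurableT mg (fun x _ => g0 x).
rewrite !preimage_setT => <- <-; apply: eq_measure_integral => A mA _.
exact: m12.
Qed.

Lemma measure_bigcupT d (T : measurableType d) (R : realType)
    (m : {measure set T -> \bar R}) (F : (set T)^nat) :
  (forall i, measurable (F i)) -> trivIset setT F ->
  (m (\bigcup_i F i) = \sum_(0 <= i <oo) m (F i))%E.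
Proof.
by move=> mF tF; apply: measure_semi_bigcup => //; exact: bigcupT_measurable.
Qed.

(** * Gluing of transport plans *)

Section gluing.
Context {R : realType} {X : metricPType R}.
Local Notation T := (borel X).
Implicit Types (mu nu lam : probability T R) (q : probability (T * T)%type R).
Local Open Scope ereal_scope.

(** Normalization serves here to package a measure of mass 1 as a [probability]; [P] is the value
    taken when the mass is 0 or infinite. *)
Lemma mnormalize_eq d (S : measurableType d) (m : {measure set S -> \bar R})
    (P : probability S R) : m setT = 1 -> mnormalize m P = m.
Proof.
move=> m1; apply/funext => A.
by rewrite /mnormalize m1 onee_eq0/= invr1 mule1.
Qed.

Lemma mul_mnormalize d (S : measurableType d) (m : {measure set S -> \bar R})
    (P : probability S R) A : 0 < m setT -> m setT < +oo ->
  m setT * mnormalize m P A = m A.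
Proof.
move=> m0 moo; rewrite /mnormalize gt_eqF// lt_eqF//=.
rewrite muleC -muleA -[X in _ * (_ * X)]fineK ?ge0_fin_numE//.
by rewrite -EFinM mulVf ?mule1// gt_eqF// fine_gt0// m0.
Qed.

(* Two plans with a common marginal are glued along a countable partition, which
   spares the disintegration of measures. *)
Lemma discrete_gluing mu nu lam q1 q2 (P : (set T)^nat) :
  coupling mu lam q1 -> coupling lam nu q2 -> (forall i, measurable (P i)) ->
  exists Q : {measure set (T * T)%type -> \bar R}^nat,
    forall i (A : set T), measurable A ->
      Q i (A `*` setT) = q1 (A `*` P i) /\ Q i (setT `*` A) = q2 (P i `*` A).
Proof.
move=> c1 c2 mP.
have mXP i : measurable (setT `*` P i : set (T * T)) by exact: measurableX.
have mPX i : measurable (P i `*` setT : set (T * T)) by exact: measurableX.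
pose a' i : {measure set T -> \bar R} := pushforward (mrestr q1 (mXP i)) fst.
pose b' i : {measure set T -> \bar R} := pushforward (mrestr q2 (mPX i)) snd.
pose a := a' measurable_fst; pose b := b' measurable_snd.
have aE i A : measurable A -> a i A = q1 (A `*` P i).
  by move=> mA; congr (q1 _); rewrite predeqE => -[x y]; split=> [[? []]|[]].
have bE i A : measurable A -> b i A = q2 (P i `*` A).
  by move=> mA; congr (q2 _); rewrite predeqE => -[x y]; split=> [[? []]|[]].
have abT i : a i setT = b i setT.
  by rewrite aE// bE// (c1 _ (mP i)).2 (c2 _ (mP i)).1.
have fb i : b i setT < +oo.
  by rewrite bE// (le_lt_trans (probability_le1 _ _))// ltry.
(* Inside a cell the two ends are made independent. The masses of [a i] and [b i] agree, so one
   factor is normalized; when they vanish, the default [nu] is multiplied by the null measure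
   [a i]. *)
exists (fun i => (a i \x mnormalize (b i) nu)%E : {measure set _ -> \bar R}).
move=> i A mA; rewrite -aE// -bE//; split.
  rewrite [LHS]product_measure1E// [X in _ * X]probability_setT mule1//.
rewrite [LHS]product_measure1E// abT.
have [b0|b0] := eqVneq (b i setT) 0.
  rewrite b0 mul0e; apply/esym/eqP; rewrite -measure_le0 -b0.
  by apply: le_measure; rewrite ?inE.
by apply: mul_mnormalize => //; rewrite lt_def measure_ge0 b0.
Qed.

(** Beyond the triangle inequality, the defect is a square divided by t (1 - t); it vanishes only
    when the two distances are in the ratio t : 1 - t. *)
Lemma mdist_sqr_split (x y z : X) (t : R) : (0 < t < 1)%R ->
  (mdist x z ^+ 2 <= t^-1 * mdist x y ^+ 2 + (1 - t)^-1 * mdist y z ^+ 2)%R.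
Proof.
move=> /andP[t0 t1]; have t1' : (0 < 1 - t)%R by rewrite subr_gt0.
apply: (@le_trans _ _ ((mdist x y + mdist y z) ^+ 2)%R).
  by rewrite lerXn2r ?nnegrE ?addr_ge0 ?mdist_ge0// mdistD.
move: (mdist x y) (mdist y z) => a b; rewrite -subr_ge0.
rewrite (_ : _ - _ = ((1 - t) * a - t * b) ^+ 2 / (t * (1 - t)))%R; last first.
  by field; rewrite !gt_eqF.
by rewrite divr_ge0 ?sqr_ge0// mulr_ge0 ?ltW.
Qed.

(** The endpoints in the middle of the two plans are not matched, but they lie in the same cell.
    Cells have diameter at most [eta], so one representative [y i] replaces both endpoints at the
    price of [eta] in each distance, and the pointwise inequality is integrated cell by cell. *)
Lemma gluing_cost mu nu lam q1 q2 (t eta kap : R) (B A0 A1 : set T) :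
  separable_space X -> coupling mu lam q1 -> coupling lam nu q2 ->
  (0 < t < 1)%R -> (0 < eta)%R -> (0 <= kap)%R ->
  measurable B -> measurable A0 -> measurable A1 -> mu A0 = 1 -> nu A1 = 1 ->
  (forall x y z : X, A0 x -> B y -> A1 z ->
    mdist x z ^+ 2 + kap <= t^-1 * mdist x y ^+ 2 + (1 - t)^-1 * mdist y z ^+ 2)%R ->
  exists2 q, coupling mu nu q &
    transport_cost q + kap%:E * lam B <=
    t^-1%:E * \int[q1]_z ((mdist (z.1 : X) (z.2 : X) + eta) ^+ 2)%:E +
    (1 - t)^-1%:E * \int[q2]_z ((mdist (z.1 : X) (z.2 : X) + eta) ^+ 2)%:E.
Proof.
move=> sX c1 c2 t01 eta0 kap0 mB mA0 mA1 muA0 nuA1 Bkap.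
have /andP[t0 t1] := t01; have t1' : (0 < 1 - t)%R by rewrite subr_gt0.
have [u du] := dense_seqP sX.
pose P : (set T)^nat := seqDU (fun n => ball (u n) (eta / 2)).
have mP i : measurable (P i).
  have mb j : @measurable _ T (ball (u j) (eta / 2)).
    exact: (@borel_open _ X _ (open_ball_metric _ _)).
  by apply: measurableD => //; apply: bigsetU_measurable => j _.
have tP : trivIset setT P := @trivIset_seqDU _ _.
have cP : \bigcup_i P i = setT.
  rewrite -seqDU_bigcup_eq -subTset => x _.
  have [n un] := du x (eta / 2)%R (divr_gt0 eta0 (ltr0Sn _ 1)).
  by exists n => //; rewrite ball_mdist.
have dP i x y : P i x -> P i y -> (mdist x y <= eta)%R.
  rewrite /P /seqDU => -[+ _] [+ _]; rewrite !ball_mdist /= => ux uy.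
  have := mdistD x (u i) y; rewrite (mdistC x (u i)); lra.
have [Q Qm] := discrete_gluing c1 c2 mP.
have QT : mseries Q 0 setT = 1.
  have cX : \bigcup_i (setT `*` P i) = setT :> set (T * T).
    by rewrite -setX_bigcupr cP setXTT.
  rewrite -(probability_setT q1) -[X in q1 X]cX measure_bigcupT//=; last 2 first.
  - by move=> i; exact: measurableX.
  - exact: trivIset_setXr.
  apply: eq_eseriesr => i _.
  by rewrite -(Qm i _ measurableT).1 setXTT.
pose q : probability (T * T)%type R := mnormalize (mseries Q 0) q1.
have qE : q = mseries Q 0 :> (set _ -> _) by apply: mnormalize_eq.
exists q.
  move=> A mA; rewrite qE; split.
    rewrite -(c1 _ mA).1 -[in RHS]cP setX_bigcupr measure_bigcupT//=; last 2 first.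
    - by move=> i; exact: measurableX.
    - exact: trivIset_setXr.
    by apply: eq_eseriesr => i _; exact: (Qm _ _ mA).1.
  rewrite -(c2 _ mA).2 -[in RHS]cP setX_bigcupl measure_bigcupT//=; last 2 first.
  - by move=> i; exact: measurableX.
  - exact: trivIset_setXl.
  by apply: eq_eseriesr => i _; exact: (Qm _ _ mA).2.
have md : measurable_fun setT (fun z : T * T => mdist (z.1 : X) (z.2 : X)).
  exact: measurable_mdist.
have mdy (y : X) : measurable_fun setT (fun x : T => mdist (x : X) y).
  apply: measurable_fun_continuous_borel => x; under eq_fun do rewrite mdistC.
  exact: mdistr_continuous.
pose bad i := (P i `&` B !=set0).
(* The representative is taken in B whenever the cell meets B, so that [Bkap] applies to the whole
   cell; empty cells get an arbitrary point. *)
have [y yP] : {y : nat -> X & forall i, (P i !=set0 -> P i (y i)) /\ (bad i -> B (y i))}.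
  apply: (@choice _ _ (fun i (y : X) => (P i !=set0 -> P i y) /\ (bad i -> B y))) => i.
  have [[x [Px Bx]]|nb] := pselect (bad i); first by exists x.
  have [[x Px]|nP] := pselect (P i !=set0); last by exists point.
  by exists x; split => // /nb.
pose b i : R := if `[< bad i >] then kap else 0%R.
have b0 i : (0 <= b i)%R by rewrite /b; case: ifP.
have lamB : kap%:E * lam B <= \sum_(0 <= i <oo) ((b i)%:E * lam (P i)).
  rewrite -[X in lam X]setIT -cP setI_bigcupr measure_bigcupT//=; last 2 first.
  - by move=> i; exact: measurableI.
  - exact: trivIset_setIl.
  rewrite -nneseriesZl//; apply: lee_nneseries => [i _ _|i _].
    by rewrite mule_ge0// lee_fin.
  rewrite /b; case: ifPn => [_|/asboolPn nb].
    by rewrite lee_wpmul2l ?lee_fin// le_measure ?inE//; exact: measurableI.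
  rewrite (_ : B `&` P i = set0) ?measure0 ?mule0 ?mul0e//.
  by rewrite -subset0 => x [Bx Px]; apply: nb; exists x.
have cE : transport_cost q =
    \sum_(0 <= i <oo) \int[Q i]_z (mdist (z.1 : X) (z.2 : X) ^+ 2)%:E.
  rewrite /transport_cost (eq_measure_integral (mseries Q 0)); last first.
    by move=> A _ _; exact: (congr1 (fun f => f A) qE).
  rewrite ge0_integral_measure_series//.
  - by move=> z _; rewrite lee_fin sqr_ge0.
  - by apply/measurable_EFinP; apply: measurable_funX.

have mX i : measurable (setT `*` P i : set (T * T)) by exact: measurableX.
have mX' i : measurable (P i `*` setT : set (T * T)) by exact: measurableX.
pose D (z : T * T) : \bar R := ((mdist (z.1 : X) (z.2 : X) + eta) ^+ 2)%:E.
have mD : measurable_fun setT D.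
  by apply/measurable_EFinP; apply: measurable_funX; apply: measurable_funD.
have D0 z : 0 <= D z by rewrite lee_fin sqr_ge0.
pose phi i (x : T) : \bar R := (mdist (x : X) (y i) ^+ 2)%:E.
have mphi i : measurable_fun setT (phi i).
  by apply/measurable_EFinP; apply: measurable_funX; exact: mdy.
have phi0 i x : 0 <= phi i x by rewrite lee_fin sqr_ge0.
(* [phi i] sees only the first coordinate, where [Q i] and the restriction of [q1] to the cell have
   the same marginal; under [q1] the second coordinate is within [eta] of [y i]. *)
have Q1 i : \int[Q i]_z phi i z.1 <= \int[q1]_(z in setT `*` P i) D z.
  rewrite -(@ge0_integral_mrestr _ _ _ _ _ (mX i)) //.
  rewrite (@eq_pushforward_integral _ _ _ _ _ _ _ (Q i) (mrestr q1 (mX i)) fst fst)//; last first.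
    move=> A mA; rewrite -setXT (Qm _ _ mA).1; congr (q1 _).
    by rewrite predeqE => -[? ?] /=; tauto.
  rewrite !ge0_integral_mrestr//; last exact: measurableT_comp.
  apply: ge0_le_integral => //.
  - by apply: measurable_funTS; exact: measurableT_comp.
  - exact: measurable_funTS.
  move=> [x x'] [_ /= Px]; rewrite lee_fin /= lerXn2r ?nnegrE ?addr_ge0 ?mdist_ge0 ?(ltW eta0)//.
  rewrite (le_trans (mdistD _ x' _))// lerD2l (dP i)//.
  by apply: (yP i).1; exists x'.
have Q2 i : \int[Q i]_z phi i z.2 <= \int[q2]_(z in P i `*` setT) D z.
  rewrite -(@ge0_integral_mrestr _ _ _ _ _ (mX' i)) //.
  rewrite (@eq_pushforward_integral _ _ _ _ _ _ _ (Q i) (mrestr q2 (mX' i)) snd snd)//; last first.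
    move=> A mA; rewrite -setTX (Qm _ _ mA).2; congr (q2 _).
    by rewrite predeqE => -[? ?] /=; tauto.
  rewrite !ge0_integral_mrestr//; last exact: measurableT_comp.
  apply: ge0_le_integral => //.
  - by apply: measurable_funTS; exact: measurableT_comp.
  - exact: measurable_funTS.
  move=> [x x'] [/= Px _]; rewrite lee_fin /= lerXn2r ?nnegrE ?addr_ge0 ?mdist_ge0 ?(ltW eta0)//.
  rewrite (le_trans (mdistD _ x _))// (mdistC x') lerD2l (dP i)//.
  by apply: (yP i).1; exists x.
(* The gain [b i] is available only for endpoints in A0 and A1, where all of the mass of [Q i]
   lies. *)
have QA i : Q i (A0 `*` A1) = lam (P i).
  rewrite -(c1 _ (mP i)).2 -(Qm _ _ measurableT).1 setXTT; apply/eqP.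
  rewrite eq_le; apply/andP; split.
    by apply: le_measure; rewrite ?inE//; exact: measurableX.
  have N1 : Q i (~` A0 `*` setT) = 0.
    apply/eqP; rewrite (Qm _ _ (measurableC mA0)).1 -measure_le0.
    rewrite (@le_trans _ _ (q1 (~` A0 `*` setT)))//.
      apply: le_measure; rewrite ?inE; [| |by move=> [x x'] []];
        by apply: measurableX => //; exact: measurableC.
    by rewrite (c1 _ (measurableC mA0)).1 probability_setC// muA0 subee.
  have N2 : Q i (setT `*` ~` A1) = 0.
    apply/eqP; rewrite (Qm _ _ (measurableC mA1)).2 -measure_le0.
    rewrite (@le_trans _ _ (q2 (setT `*` ~` A1)))//.
      apply: le_measure; rewrite ?inE; [| |by move=> [x x'] []];
        by apply: measurableX => //; exact: measurableC.
    by rewrite (c2 _ (measurableC mA1)).2 probability_setC// nuA1 subee.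
  have mA01 : measurable (A0 `*` A1 : set (T * T)) by exact: measurableX.
  rewrite (_ : setT = A0 `*` A1 `|` (~` A0 `*` setT `|` setT `*` ~` A1)); last first.
    rewrite eqEsubset; split => // -[x x'] _ /=.
    by have [?|?] := pselect (A0 x); have [?|?] := pselect (A1 x'); tauto.
  rewrite measureU0 ?lexx//.
    by apply: measurableU; apply: measurableX => //; exact: measurableC.
  by rewrite measureU0//; apply: measurableX => //; exact: measurableC.
have t0i : (0 <= t^-1)%R by rewrite invr_ge0 ltW.
have t1i : (0 <= (1 - t)^-1)%R by rewrite invr_ge0 ltW.
have cell i : \int[Q i]_z (mdist (z.1 : X) (z.2 : X) ^+ 2)%:E + (b i)%:E * lam (P i) <=
    t^-1%:E * \int[q1]_(z in setT `*` P i) D z +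
    (1 - t)^-1%:E * \int[q2]_(z in P i `*` setT) D z.
  apply: (@le_trans _ _ (t^-1%:E * \int[Q i]_z phi i z.1 +
      (1 - t)^-1%:E * \int[Q i]_z phi i z.2)); last first.
    by apply: leeD; rewrite lee_wpmul2l ?lee_fin.
  have mA01 : measurable (A0 `*` A1 : set (T * T)) by exact: measurableX.
  have mp1 : measurable_fun setT (fun z : T * T => phi i z.1) by exact: measurableT_comp.
  have mp2 : measurable_fun setT (fun z : T * T => phi i z.2) by exact: measurableT_comp.
  have md2 : measurable_fun setT
      (fun z : T * T => (mdist (z.1 : X) (z.2 : X) ^+ 2)%:E).
    by apply/measurable_EFinP; apply: measurable_funX.
  have m1 : measurable_fun setT (fun z : T * T => (\1_(A0 `*` A1) z : R)%:E).
    by apply/measurable_EFinP; exact: measurable_indic.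
  rewrite -QA -(setIT (A0 `*` A1)) -integral_indic//.
  rewrite -!ge0_integralZl_EFin//.
  rewrite -!ge0_integralD//; try (by move=> z _; rewrite ?mule_ge0 ?lee_fin ?sqr_ge0);
    try exact: measurable_funeM.
  apply: ge0_le_integral => //.
  - by move=> z _; rewrite adde_ge0// ?mule_ge0// lee_fin// sqr_ge0.
  - by apply: emeasurable_funD => //; exact: measurable_funeM.
  - by apply: emeasurable_funD; exact: measurable_funeM.
  move=> [x z] _ /=; rewrite -!EFinM -!EFinD lee_fin (mdistC z).
  have tri := mdist_sqr_split x (y i) z t01.
  rewrite /b; case: ifPn => [/asboolP badi|_]; last by rewrite mul0r addr0.
  rewrite indicE; case: (boolP ((x, z) \in _)) => [|_]; last by rewrite mulr0 addr0.
  by rewrite inE mulr1 => -[Ax Az]; apply: Bkap => //; exact: (yP i).2.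
rewrite cE; apply: le_trans (leeD2l _ lamB) _.
rewrite -nneseriesD; last 2 first.
- by move=> i _ _; apply: integral_ge0 => z _; rewrite lee_fin sqr_ge0.
- by move=> i _ _; rewrite mule_ge0// lee_fin.
apply: (le_trans (lee_nneseries _ (fun i _ => cell i))).
  move=> i _ _; rewrite adde_ge0 ?mule_ge0 ?lee_fin//.
  by apply: integral_ge0 => z _; rewrite lee_fin sqr_ge0.
rewrite nneseriesD; last 2 first.
- by move=> i _ _; rewrite mule_ge0 ?lee_fin// integral_ge0.
- by move=> i _ _; rewrite mule_ge0 ?lee_fin// integral_ge0.
rewrite !nneseriesZl; last 2 first.
- by move=> i _; rewrite integral_ge0.
- by move=> i _; rewrite integral_ge0.
rewrite -!ge0_integral_bigcup//.
- by rewrite -setX_bigcupr -setX_bigcupl cP setXTT.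
- exact: measurable_funTS.
- exact: trivIset_setXl.
- exact: measurable_funTS.
- exact: trivIset_setXr.
Qed.

End gluing.

(** * Where a Wasserstein geodesic is concentrated *)

Section geodesic_concentration.
Context {R : realType} {X : metricPType R}.
Local Notation T := (borel X).
Implicit Types (mu nu lam : probability T R) (q : probability (T * T)%type R).

Lemma coupling_setX mu nu q (A B : set T) : coupling mu nu q ->
  measurable A -> measurable B -> mu A = 1%E -> nu B = 1%E ->
  q (~` (A `*` B)) = 0%E.
Proof.
move=> c mA mB muA nuB; apply/eqP; rewrite -measure_le0.
have mAT : measurable (~` A `*` setT : set (T * T)).
  by apply: measurableX => //; exact: measurableC.
have mTB : measurable (setT `*` ~` B : set (T * T)).
  by apply: measurableX => //; exact: measurableC.
apply: (@le_trans _ _ (q (~` A `*` setT `|` setT `*` ~` B))).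
  apply: le_measure; rewrite ?inE; [|exact: measurableU|].
    by apply: measurableC; exact: measurableX.
  by move=> [x y] /= /not_andP[]; tauto.
apply: (le_trans (measureU2 _ mAT mTB)).
have N1 : (q (~` A `*` setT) <= 0)%E.
  by rewrite (c _ (measurableC mA)).1 probability_setC// muA subee.
have N2 : (q (setT `*` ~` B) <= 0)%E.
  by rewrite (c _ (measurableC mB)).2 probability_setC// nuB subee.
by rewrite -[leRHS]adde0; apply: leeD; [exact: N1|exact: N2].
Qed.

Lemma transport_cost_le mu nu q (A B : set T) (D : R) : separable_space X ->
  coupling mu nu q -> measurable A -> measurable B -> mu A = 1%E -> nu B = 1%E ->
  (forall x y : X, A x -> B y -> mdist x y <= D) ->
  (transport_cost q <= (D ^+ 2)%:E)%E.
Proof.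
move=> sX c mA mB muA nuB dD; have mAB := measurableX mA mB.
rewrite /transport_cost.
have md2 : measurable_fun setT
    (fun z : T * T => (mdist (z.1 : X) (z.2 : X) ^+ 2)%:E).
  by apply/measurable_EFinP; apply: measurable_funX; exact: measurable_mdist.
rewrite (ge0_negligible_integral (mu := q) (measurableC mAB))//; last 2 first.
- by move=> z _; rewrite lee_fin sqr_ge0.
- exact: (coupling_setX c mA mB muA nuB).
rewrite setDE setTI setCK.
apply: (@le_trans _ _ (\int[q]_(z in A `*` B) (cst (D ^+ 2)%:E z))%E).
  apply: ge0_le_integral => //.
  - by move=> z _; rewrite lee_fin sqr_ge0.
  - exact: measurable_funTS.
  move=> [x y] [/= Ax By]; rewrite lee_fin lerXn2r ?nnegrE ?mdist_ge0 ?dD//.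
  by rewrite (le_trans (mdist_ge0 x y))// dD.
rewrite integral_cst// -[leRHS]mule1 lee_wpmul2l ?lee_fin ?sqr_ge0//.
exact: probability_le1.
Qed.

(** The cross term is absorbed by 2 d <= d^2 + 1, which keeps the error linear in the transport
    cost. *)
Lemma shifted_cost_le q (eta : R) : separable_space X -> 0 < eta ->
  (\int[q]_z ((mdist (z.1 : X) (z.2 : X) + eta) ^+ 2)%:E <=
   (1 + eta)%:E * transport_cost q + (eta + eta ^+ 2)%:E)%E.
Proof.
move=> sX eta0.
have md2 : measurable_fun setT
    (fun z : T * T => (mdist (z.1 : X) (z.2 : X) ^+ 2)%:E).
  by apply/measurable_EFinP; apply: measurable_funX; exact: measurable_mdist.
have e0 : 0 <= eta + eta ^+ 2 by rewrite addr_ge0 ?sqr_ge0 ?ltW.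
have e1 : 0 <= 1 + eta by rewrite addr_ge0 ?ltW.
apply: (@le_trans _ _ (\int[q]_z ((1 + eta)%:E * (mdist (z.1 : X) (z.2 : X) ^+ 2)%:E
    + cst (eta + eta ^+ 2)%:E z))%E).
  apply: ge0_le_integral => //.
  - by move=> z _; rewrite lee_fin sqr_ge0.
  - apply/measurable_EFinP; apply: measurable_funX; apply: measurable_funD => //.
    exact: measurable_mdist.
  - by apply: emeasurable_funD => //; exact: measurable_funeM.
  move=> [x y] _ /=; rewrite lee_fin -subr_ge0.
  rewrite (_ : _ - _ = eta * (mdist x y - 1) ^+ 2); last by ring.
  by rewrite mulr_ge0 ?sqr_ge0// ltW.
rewrite ge0_integralD//; last 2 first.
- by move=> z _; rewrite mule_ge0 ?lee_fin ?sqr_ge0.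
- exact: measurable_funeM.
rewrite integral_cst// ge0_integralZl_EFin//; last first.
  by move=> z _; rewrite lee_fin sqr_ge0.
by rewrite [X in (_ + _ * X)%E]probability_setT mule1.
Qed.

Lemma W2_sqr mu nu (r : R) : 0 <= r -> W2 mu nu = r%:E ->
  ereal_inf [set transport_cost q | q in coupling mu nu] = (r ^+ 2)%:E.
Proof.
rewrite /W2; set I := ereal_inf _ => r0 h.
have I0 : (0 <= I)%E.
  apply: le_ereal_inf_tmp => _ [q _ <-]; apply: integral_ge0 => z _.
  by rewrite lee_fin sqr_ge0.
by rewrite -(sqr_sqrte I0) h -EFin_expe.
Qed.

(* Going through B costs kap more than the direct transport, and a geodesic
   attains the optimal cost, so it cannot charge B. *)
Lemma W2_geodesic_null mu0 mu1 q0 (mu : R -> probability T R)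
    (t kap D : R) (A0 A1 B : set T) :
  separable_space X -> W2_geodesic mu0 mu1 mu -> coupling mu0 mu1 q0 ->
  0 < t < 1 -> 0 < kap ->
  measurable A0 -> measurable A1 -> measurable B ->
  mu0 A0 = 1%E -> mu1 A1 = 1%E ->
  (forall x y : X, A0 x -> A1 y -> mdist x y <= D) ->
  (forall x y z : X, A0 x -> B y -> A1 z ->
    mdist x z ^+ 2 + kap <= t^-1 * mdist x y ^+ 2 + (1 - t)^-1 * mdist y z ^+ 2) ->
  mu t B = 0%E.
Proof.
move=> sX [mu00 mu11 mug] c0 t01 kap0 mA0 mA1 mB muA0 muA1 dD Bkap.
have /andP[t0 t1] := t01; have t1' : 0 < 1 - t by rewrite subr_gt0.
have c0D := transport_cost_le sX c0 mA0 mA1 muA0 muA1 dD.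
set I := ereal_inf [set transport_cost q | q in coupling mu0 mu1].
have I0 : (0 <= I)%E.
  apply: le_ereal_inf_tmp => _ [q _ <-]; apply: integral_ge0 => z _.
  by rewrite lee_fin sqr_ge0.
(* The optimal cost has to be finite, because it is cancelled from both sides in the end. *)
have Ifin : I \is a fin_num.
  rewrite ge0_fin_numE// (le_lt_trans _ (ltry (D ^+ 2)))// (le_trans _ c0D)//.
  by apply: ereal_inf_lbound; exists q0.
have W2E : W2 mu0 mu1 = (Num.sqrt (fine I))%:E by rewrite /W2 -/I -(fineK Ifin).
set w := fine I in W2E.
have w0 : 0 <= w by exact: fine_ge0.
(* Plans between intermediate measures are taken optimal up to [eta], so no minimizer has to
   exist. *)
have approx s s' (eta : R) : 0 <= s <= 1 -> 0 <= s' <= 1 -> 0 < eta ->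
  exists2 q, coupling (mu s) (mu s') q &
    (transport_cost q <= ((s - s') ^+ 2 * w + eta)%:E)%E.
  move=> s01 s'01 eta0; have := mug s s'; rewrite !in_itv /= => /(_ s01 s'01).
  rewrite W2E -EFinM => /W2_sqr -/(_ (mulr_ge0 (normr_ge0 _) (sqrtr_ge0 _))).
  rewrite exprMn sqr_sqrtr// real_normK ?num_real// => h.
  have [|_ [q cq <-] hq] := @lb_ereal_inf_adherent _
    [set transport_cost q | q in coupling (mu s) (mu s')] _ eta0.
    by rewrite h.
  by exists q => //; rewrite EFinD -h ltW.
have muB : mu t B \is a fin_num.
  by rewrite ge0_fin_numE// (le_lt_trans (probability_le1 _ mB))// ltry.
suff : fine (mu t B) <= 0.
  move=> h; apply/eqP; rewrite -measure_le0.
  by move: h; rewrite -lee_fin fineK.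
(* The weights turn the costs t^2 w and (1 - t)^2 w into t w and (1 - t) w, whose sum w cancels
   against the cost of the glued plan; [C] collects what is multiplied by [eta]. *)
set b := fine _; pose C := w + 4 * t^-1 + 4 * (1 - t)^-1.
have key eta : 0 < eta -> eta <= 1 -> kap * b <= eta * C.
  move=> eta0 eta1.
  have tI : 0 <= t <= 1 by rewrite !ltW.
  have I0' : 0 <= (0 : R) <= 1 by rewrite lexx ler01.
  have I1' : 0 <= (1 : R) <= 1 by rewrite lexx ler01.
  have [q1 c1 h1] := approx 0 t eta I0' tI eta0.
  have [q2 c2 h2] := approx t 1 eta tI I1' eta0.
  have c1' : coupling mu0 (mu t) q1 by move=> A mA; rewrite -mu00//; exact: c1.
  have c2' : coupling (mu t) mu1 q2 by move=> A mA; rewrite -mu11//; exact: c2.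
  have [q cq hq] := gluing_cost sX c1' c2' t01 eta0 (ltW kap0) mB mA0 mA1 muA0 muA1 Bkap.
  have Iq : (w%:E <= transport_cost q)%E.
    by rewrite /w fineK//; apply: ereal_inf_lbound; exists q.
  have shift q' (r : R) : (transport_cost q' <= (r + eta)%:E)%E ->
      (\int[q']_z ((mdist (z.1 : X) (z.2 : X) + eta) ^+ 2)%:E <=
       ((1 + eta) * r + 4 * eta)%:E)%E.
    move=> hr; apply: (le_trans (shifted_cost_le q' sX eta0)).
    apply: (@le_trans _ _ ((1 + eta)%:E * (r + eta)%:E + (eta + eta ^+ 2)%:E)%E).
      by apply: leeD2r; apply: lee_wpmul2l => //; rewrite lee_fin addr_ge0// ltW.
    by rewrite -EFinM -EFinD lee_fin; nra.
  have {hq} : (w%:E + (kap * b)%:E <=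
      (t^-1 * ((1 + eta) * ((0 - t) ^+ 2 * w) + 4 * eta))%:E +
      ((1 - t)^-1 * ((1 + eta) * ((t - 1) ^+ 2 * w) + 4 * eta))%:E)%E.
    have -> : (kap * b)%:E = (kap%:E * mu t B)%E by rewrite EFinM /b fineK.
    apply: le_trans (leeD2r _ Iq) _; apply: (le_trans hq).
    by rewrite (EFinM t^-1) (EFinM (1 - t)^-1); apply: leeD;
      (apply: lee_wpmul2l; last exact: shift); rewrite lee_fin invr_ge0 ltW.
  rewrite -!EFinD lee_fin.
  rewrite (_ : t^-1 * _ + _ = w + eta * C); last by rewrite /C; field; rewrite !gt_eqF.
  by rewrite lerD2l.
apply/ler_addgt0Pr => e e0; rewrite add0r.
have C0 : 0 < 1 + C.
  by rewrite ltr_pwDl// !addr_ge0// mulr_ge0// invr_ge0 ltW.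
pose eta := Num.min 1 (e * kap / (1 + C)).
have eta0 : 0 < eta by rewrite lt_min ltr01 divr_gt0// mulr_gt0.
have eta1 : eta <= 1 by rewrite /eta ge_min lexx.
have eta2 : eta * (1 + C) <= e * kap by rewrite -ler_pdivlMr// /eta ge_min lexx orbT.
rewrite -(ler_pM2l kap0) (le_trans (key eta eta0 eta1))// (mulrC kap).
by rewrite (le_trans _ eta2)// ler_wpM2l ?lerDr// ltW.
Qed.

End geodesic_concentration.

(** * Integration against a density and Jensen's inequality *)

Section change_of_density.
Context d (T : measurableType d) (R : realType).
Variables (m mu : {measure set T -> \bar R}) (rho : T -> R).
Hypothesis rho0 : forall x, 0 <= rho x.
Hypothesis mrho : measurable_fun setT rho.
Hypothesis muE : forall A, measurable A -> mu A = (\int[m]_(x in A) (rho x)%:E)%E.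
Local Open Scope ereal_scope.

Let mrho' : measurable_fun setT (fun x => (rho x)%:E).
Proof. exact/measurable_EFinP. Qed.

Import HBNNSimple.

Let integral_density_nnsfun (f : {nnsfun T >-> R}) :
  \int[mu]_x (f x)%:E = \int[m]_x ((f x)%:E * (rho x)%:E).
Proof.
rewrite integralT_nnsfun sintegralE.
under [RHS]eq_integral => x _.
  rewrite fimfunE -fsumEFin//= ge0_mule_fsuml; last first.
    by move=> r; rewrite EFinM nnfun_muleindic_ge0.
  over.
rewrite ge0_integral_fsum//; last 2 first.
- move=> r; apply: emeasurable_funM => //.
  by apply/measurable_EFinP; exact: measurableT_comp.
- move=> r x _; apply: mule_ge0; last by rewrite lee_fin.
  by rewrite EFinM nnfun_muleindic_ge0.
apply: eq_fsbigr => r _.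
have [r0|r0] := ltP r 0%R.
  rewrite preimage_nnfun0// measure0 mule0 integral0_eq// => x _.
  by rewrite indic0 mulr0 mul0e.
rewrite muE// integral_mkcond -ge0_integralZl_EFin//; last 2 first.
- by move=> x _; rewrite patchE; case: ifP => // _; rewrite lee_fin.
- by apply/(measurable_restrictT _ _).1 => //; exact: measurable_funTS.
apply: eq_integral => x _; rewrite patchE indicE.
by case: ifP; rewrite /= ?mulr1 ?mulr0 ?mul0e ?mule0.
Qed.

Lemma integral_density (f : T -> \bar R) :
  measurable_fun setT f -> (forall x, 0 <= f x) ->
  \int[mu]_x f x = \int[m]_x (f x * (rho x)%:E).
Proof.
move=> mf f0; pose f_ := nnsfun_approx measurableT mf.
have fE x : f x = limn (fun n => (f_ n x)%:E).
  by apply/esym/cvg_lim => //; exact: cvg_nnsfun_approx.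
transitivity (\int[mu]_x limn (fun n => (f_ n x)%:E)).
  by apply: eq_integral => x _.
rewrite monotone_convergence//; last 3 first.
  by move=> n; exact/measurable_EFinP.
  by move=> n z _; rewrite lee_fin.
  by move=> z _ a b ab; rewrite lee_fin; exact/lefP/nd_nnsfun_approx.
rewrite (_ : (fun _ => _) = (fun n => \int[m]_x ((f_ n x)%:E * (rho x)%:E))); last first.
  by apply/funext => n; rewrite integral_density_nnsfun.
rewrite -monotone_convergence//; last 3 first.
- by move=> n; apply: emeasurable_funM => //; exact/measurable_EFinP.
- by move=> n x _; rewrite mule_ge0// lee_fin.
- move=> x _ a b ab; rewrite lee_wpmul2r ?lee_fin//.
  exact/lefP/nd_nnsfun_approx.
apply: eq_integral => x _; rewrite fE limeMr//.
by apply/cvg_ex; exists (f x); exact: cvg_nnsfun_approx.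
Qed.

End change_of_density.

(** The integral of a nonnegative function is a supremum over the simple functions below it, hence
    monotone without measurability. This spares a study of the integrand of [CDstar] as a function
    of the pair. *)
Lemma le_integral_nonmeasurable d (T : measurableType d) (R : realType)
    (mu : {measure set T -> \bar R}) (f g : T -> \bar R) :
  (forall x, 0 <= f x)%E -> (forall x, f x <= g x)%E ->
  (\int[mu]_x f x <= \int[mu]_x g x)%E.
Proof.
move=> f0 fg; have g0 x : (0 <= g x)%E by rewrite (le_trans (f0 x)).
rewrite !ge0_integralTE//; apply: ereal_sup_le => _ /= [h hf <-].
by exists h => // x; rewrite (le_trans (hf x)).
Qed.

Section powers.
Context {R : realType}.

(** With u = 1 / (M rho) this is the tangent line at 1 of the concave function u^al, scaled by
    M^al. *)
Lemma powR_tangent (rho M al : R) : 0 < rho -> 0 < M -> 0 <= al <= 1 ->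
  rho `^ (- al) <= M `^ al * (al * (M^-1 * rho `^ (-1)) + (1 - al)).
Proof.
move=> rho0 M0 /andP[al0 al1].
pose s := - (ln rho + ln M).
have -> : M^-1 * rho `^ (-1) = expR s.
  by rewrite /s opprD expRD !expRN !lnK ?posrE// powR_inv1 ?ltW// mulrC.
have -> : rho `^ (- al) = M `^ al * expR (al * s).
  rewrite /powR !gt_eqF// -expRD; congr expR; rewrite /s; ring.
rewrite ler_pM2l ?powR_gt0//.
(* The tangent of the exponential at al s, used at x = s and x = 0 with weights al and 1 - al; the
   linear terms then cancel. *)
have h x : expR (al * s) * (1 + x - al * s) <= expR x.
  rewrite -[X in _ <= expR X](subrK (al * s)) expRD mulrC ler_pM2r ?expR_gt0//.
  by rewrite -addrA expR_ge1Dx.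
have := h s; have := h 0; rewrite expR0; nra.
Qed.

Lemma powR_inv (a al : R) : 0 < a -> (a^-1) `^ (- al) = a `^ al.
Proof.
move=> a0; rewrite /powR !gt_eqF ?invr_gt0//; congr expR.
by rewrite lnV ?posrE// mulrNN.
Qed.

End powers.

(** Jensen's inequality for a concave power: integrating [powR_tangent] at the mean value leaves
    only the integral of 1 / rho against mu, which is at most m S. *)
Lemma density_power_le (R : realType) (X : metricPType R)
    (m : {measure set (borel X) -> \bar R}) (mu : probability (borel X) R)
    (rho : X -> R) (S : set (borel X)) (al : R) :
  density m mu rho -> measurable S -> (m S < +oo)%E -> mu (~` S) = 0%E ->
  0 < al <= 1 ->
  (\int[mu]_x (rho x `^ (- al))%:E <= (fine (m S) `^ al)%:E)%E.
Proof.
move=> [mrho rho0 muE] mS mSoo muS /andP[al0 al1].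
have muS1 : mu S = 1%E.
  by rewrite -(setCK S) (probability_setC _ (measurableC mS)) muS sube0.
pose M := fine (m S).
have ME : m S = M%:E by rewrite /M fineK// ge0_fin_numE.
have M0 : 0 < M.
  rewrite lt_def fine_ge0// andbT; apply/eqP => M00.
  have /eqP := muS1; rewrite muE// null_set_integral ?ME ?M00//.
    by rewrite eq_sym onee_eq0.
  by apply: measurable_funTS; exact/measurable_EFinP.
have mpow (p : R) : measurable_fun [set: borel X] (fun x => (rho x `^ p)%:E).
  by apply/measurable_EFinP; apply: measurableT_comp (measurable_powR _) mrho.
rewrite (ge0_negligible_integral (mu := mu) (measurableC mS))//; last first.
  by move=> x _; rewrite lee_fin powR_ge0.
rewrite setDE setTI setCK.
apply: (@le_trans _ _ (\int[mu]_(x in S) ((M `^ al * al * M^-1)%:E * (rho x `^ (-1))%:E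
   + cst (M `^ al * (1 - al))%:E x))%E).
  apply: ge0_le_integral => //.
  - by move=> x _; rewrite lee_fin powR_ge0.
  - exact: measurable_funTS.
  - by apply: measurable_funTS; apply: emeasurable_funD => //; exact: measurable_funeM.
  move=> x _; rewrite -EFinM -EFinD lee_fin.
  (* Where the density vanishes, both powers are 0 by convention. *)
  have := rho0 x; rewrite le_eqVlt => /predU1P[<-|rx0].
    rewrite !powR0 ?oppr_eq0 ?gt_eqF// mulr0 add0r mulr_ge0 ?powR_ge0//.
    by rewrite subr_ge0.
  have al01 : 0 <= al <= 1 by rewrite ltW.
  apply: (le_trans (powR_tangent rx0 M0 al01)).
  by rewrite le_eqVlt; apply/orP; left; apply/eqP; ring.
have c0 : 0 <= M `^ al * al * M^-1 by rewrite !mulr_ge0 ?powR_ge0 ?invr_ge0 ?ltW.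
have c1 : 0 <= M `^ al * (1 - al) by rewrite mulr_ge0 ?powR_ge0 ?subr_ge0.
rewrite ge0_integralD//; last 2 first.
- by move=> x _; rewrite -EFinM lee_fin mulr_ge0 ?powR_ge0.
- by apply: measurable_funeM; exact: measurable_funTS.
rewrite ge0_integralZl_EFin//; last 2 first.
- by move=> x _; rewrite lee_fin powR_ge0.
- exact: measurable_funTS.
rewrite integral_cst// [X in (_ + _ * X)%E]muS1 mule1.
(* Against m the integrand becomes rho^-1 rho, which is 1 or 0 according as rho is positive or
   not. *)
have inv_le : (\int[mu]_(x in S) (rho x `^ (-1))%:E <= M%:E)%E.
  rewrite integral_mkcond (@integral_density _ (borel X) R m mu rho rho0 mrho muE)//; last 2 first.
  - by apply/(measurable_restrictT _ _).1 => //; exact: measurable_funTS.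
  - by move=> x; rewrite patchE; case: ifP => // _; rewrite lee_fin powR_ge0.
  rewrite -ME -[X in (_ <= m X)%E](setIT S) -integral_indic//.
  apply: le_integral_nonmeasurable => x.
    rewrite mule_ge0 ?lee_fin// patchE; case: ifP => // _.
    by rewrite lee_fin powR_ge0.
  rewrite patchE indicE; case: (x \in S); rewrite ?mul0e//= -EFinM lee_fin.
  have := rho0 x; rewrite le_eqVlt => /predU1P[<-|rx0]; first by rewrite mulr0.
  by rewrite (powR_inv1 (ltW rx0)) mulVf// gt_eqF.
apply: (@le_trans _ _ ((M `^ al * al * M^-1)%:E * M%:E + (M `^ al * (1 - al))%:E)%E).
  by apply: leeD2r; apply: lee_wpmul2l; rewrite ?lee_fin.
rewrite -EFinM -EFinD lee_fin le_eqVlt; apply/orP; left; apply/eqP.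
by field; rewrite gt_eqF.
Qed.

(** * Bounds for the distortion coefficients *)

Section distortion.
Context {R : realType}.

Lemma sin_bounds (x : R) : 0 <= x <= 1 -> x * cos 1 <= sin x <= x.
Proof.
move=> /andP[x0 x1].
have [|c] := @MVT_segment R sin cos 0 x x0.
  by apply: continuous_subspaceT => y; exact: continuous_sin.
rewrite in_itv /= sin0 !subr0 => /andP[c0 cx] ->.
have c1 : cos 1 <= cos c.
  have [->//|cn1] := eqVneq c 1.
  have pi1 : 1 <= pi :> R.
    have := @pihalf_ge1 R; lra.
  have I1 : (1 : R) \in `[0, pi]%R by rewrite in_itv/= ler01.
  have Ic : c \in `[0, pi]%R by rewrite in_itv/= c0 (le_trans cx)// (le_trans x1).
  by apply/ltW; rewrite ltr_cos// lt_neqAle cn1 (le_trans cx).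
by rewrite mulrC ler_wpM2r//=; apply: ler_piMl => //; exact: cos_le1.
Qed.

Lemma sinh_bounds (x : R) : 0 <= x <= 1 ->
  x * expR (- 1) <= sinh x <= x * expR 1.
Proof.
move=> /andP[x0 x1].
have e1 : 1 - expR (- (2 * x)) <= 2 * x.
  by have := expR_ge1Dx (- (2 * x)); lra.
have e2 : 2 * x <= expR (2 * x) - 1.
  by have := expR_ge1Dx (2 * x); lra.
have s1 : sinh x = expR x * (1 - expR (- (2 * x))) / 2.
  by rewrite /sinh mulrBr mulr1 -expRD; congr ((_ - expR _) / 2); ring.
have s2 : sinh x = expR (- x) * (expR (2 * x) - 1) / 2.
  by rewrite /sinh mulrBr mulr1 -expRD; congr ((expR _ - _) / 2); ring.
have l1 : expR x <= expR 1 by rewrite ler_expR.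
have l2 : expR (- 1) <= expR (- x) by rewrite ler_expR lerN2.
have g1 := expR_gt0 x; have g2 := expR_gt0 (- x).
apply/andP; split; [rewrite s2|rewrite s1]; nra.
Qed.

Lemma sinh_ge0 (x : R) : 0 <= x -> 0 <= sinh x.
Proof.
by move=> x0; rewrite /sinh divr_ge0// subr_ge0 ler_expR (le_trans _ x0)// oppr_le0.
Qed.

Lemma sigma_ge0 (K N t th : R) : 0 < N -> 0 <= t <= 1 -> 0 <= th ->
  (0 <= sigma K N t th)%E.
Proof.
move=> N0 /andP[t0 t1] th0; rewrite /sigma.
case: ifPn => // nK; case: ifPn => [_|_]; first by rewrite lee_fin.
case: ifPn => [K0|_]; last first.
  by rewrite lee_fin divr_ge0// sinh_ge0// !mulr_ge0 ?sqrtr_ge0.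
move: nK; rewrite K0 /= -ltNge => nK.
have phipi : Num.sqrt (K / N) * th < pi.
  rewrite -(@ltr_pXn2r _ 2)// ?nnegrE ?mulr_ge0 ?sqrtr_ge0 ?pi_ge0//.
  rewrite exprMn sqr_sqrtr ?divr_ge0 ?ltW// -(ltr_pM2l N0).
  by rewrite [ltLHS](_ : _ = K * th ^+ 2)//; field; rewrite gt_eqF.
have phi0 : 0 <= Num.sqrt (K / N) * th by rewrite mulr_ge0 ?sqrtr_ge0.
rewrite lee_fin mulrAC divr_ge0// sin_ge0_pi//; last by rewrite phi0 ltW.
rewrite mulr_ge0//= (le_trans _ (ltW phipi))//.
by first [exact: ler_piMl | exact: ler_piMr].
Qed.

(** Since the curvature bound holds for every N' >= N, the exponent may be chosen. The coefficient
    is then at least a multiple of its flat value t, and the factor c does not degenerate as t tends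
    to 1. *)
Lemma sigma_lower_bound (K N D : R) : 1 <= N -> 0 <= D ->
  exists N' c : R, [/\ N <= N', 0 < c &
    forall t th, 0 <= t <= 1 -> 0 <= th <= D -> ((t * c)%:E <= sigma K N' t th)%E].
Proof.
move=> N1 D0.
(* This N' makes the angle sqrt (|K| / N') * th at most 1. *)
pose N' := Num.max N (`|K| * D ^+ 2).
(* For angles f in (0, 1], sin (t f) / sin f is at least t cos 1 and sinh (t f) / sinh f at least t
   e^-2. *)
pose c : R := Num.min (cos 1) (expR (- 1) ^+ 2).
have N'0 : 0 < N' by rewrite lt_max (lt_le_trans ltr01).
have c0 : 0 < c by rewrite lt_min cos1_gt0 exprn_gt0// expR_gt0.
have c1 : c <= 1 by rewrite /c ge_min cos_le1.
exists N', c; split => //; first by rewrite le_max lexx.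
move=> t th /andP[t0 t1] /andP[th0 thD].
have tc : t * c <= t by apply: ler_piMr.
rewrite /sigma; case: ifPn => [_|_]; first by rewrite leey.
case: ifPn => [_|]; first by rewrite lee_fin.
rewrite negb_or => /andP[K0 thn0].
have thpos : 0 < th by rewrite lt_def thn0.
have phi k : `|k| = `|K| -> 0 < k ->
    0 < Num.sqrt (k / N') * th /\ Num.sqrt (k / N') * th <= 1.
  move=> kK k0; split; first by rewrite mulr_gt0// sqrtr_gt0 divr_gt0.
  rewrite -(@ler_pXn2r _ 2)// ?nnegrE ?mulr_ge0 ?sqrtr_ge0//.
  have kN : 0 <= k / N' by rewrite divr_ge0// ltW.
  rewrite exprMn sqr_sqrtr// expr1n -(ler_pM2l N'0) mulr1.
  rewrite [leLHS](_ : _ = k * th ^+ 2); last by field; rewrite gt_eqF.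
  rewrite /N' le_max; apply/orP; right; rewrite -kK (gtr0_norm k0).
  by rewrite ler_pM2l// lerXn2r.
have tphi (f : R) : 0 < f /\ f <= 1 -> 0 <= t * f <= 1.
  by move=> [f0 f1]; rewrite (mulr_ge0 t0 (ltW f0)) mulr_ile1// ltW.
case: ifPn => [Kpos|Kneg].
  have f01 := phi K erefl Kpos; move: (f01) => [f0 f1].
  rewrite mulrAC (mulrC _ t); move: (Num.sqrt _ * th) f01 f0 f1 => f f01 f0 f1.
  have /andP[s1 s2] : f * cos 1 <= sin f <= f by apply: sin_bounds; rewrite ltW.
  have /andP[s3 _] := sin_bounds (tphi _ f01).
  have sf0 : 0 < sin f by rewrite (lt_le_trans _ s1)// mulr_gt0// cos1_gt0.
  rewrite lee_fin ler_pdivlMr//; apply: le_trans s3.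
  have cc : c <= cos 1 by rewrite /c ge_min lexx.
  by rewrite -!mulrA ler_wpM2l// mulrC; apply: ler_pM => //; exact: ltW.
have Kneg' : 0 < - K by rewrite oppr_gt0 lt_neqAle K0 leNgt.
have f01 := phi (- K) (normrN _) Kneg'; move: (f01) => [f0 f1].
rewrite [X in sinh X / _]mulrAC [X in sinh X / _](mulrC _ t); move: (Num.sqrt _ * th) f01 f0 f1 => f f01 f0 f1.
have /andP[s1 s2] : f * expR (- 1) <= sinh f <= f * expR 1.
  by apply: sinh_bounds; rewrite ltW.
have /andP[s3 _] := sinh_bounds (tphi _ f01).
have sf0 : 0 < sinh f by rewrite (lt_le_trans _ s1)// mulr_gt0// expR_gt0.
rewrite lee_fin ler_pdivlMr//; apply: le_trans s3.
rewrite -!mulrA ler_wpM2l//.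
apply: (@le_trans _ _ (expR (- 1) ^+ 2 * (f * expR 1))).
  have cc : c <= expR (- 1) ^+ 2 by rewrite /c ge_min lexx orbT.
  by apply: ler_pM => //; exact: ltW.
by rewrite expr2 mulrCA -(mulrA (expR _)) -expRD addNr expR0 mulr1.
Qed.

End distortion.

(** * A Brunn-Minkowski inequality for almost intermediate points *)

Section uniform_distribution.
Context {R : realType} {X : metricPType R}.
Variables (m : {measure set (borel X) -> \bar R}) (A : set (borel X)).
Hypotheses (mA : measurable A) (A0 : (0 < m A)%E) (Aoo : (m A < +oo)%E).

Lemma uniform_density : bounded_in (A : set X) ->
  exists mu : probability (borel X) R,
    [/\ density m mu (fun x => (fine (m A))^-1 * \1_A x),
        bounded_support mu & mu A = 1%E].
Proof.
move=> [x [r Ar]].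
have a0 : 0 < fine (m A) by rewrite fine_gt0// A0.
exists (mnormalize (mrestr m mA) \d_point).
have muE B : mnormalize (mrestr m mA) \d_point B = (m (B `&` A) * (fine (m A))^-1%:E)%E.
  by rewrite /mnormalize /= /mrestr setTI gt_eqF// lt_eqF.
have muA1 : mnormalize (mrestr m mA) \d_point A = 1%E.
  rewrite muE setIid -[X in (X * _)%E](@fineK _ (m A)) ?ge0_fin_numE//.
  by rewrite -EFinM divff// gt_eqF.
split => //.
- split.
  + by apply: measurable_funM => //; exact: measurable_indic.
  + by move=> y; rewrite mulr_ge0// invr_ge0 ltW.
  + move=> B mB; rewrite [LHS]muE.
    under eq_integral do rewrite EFinM.
    rewrite ge0_integralZl_EFin//; try (by rewrite invr_ge0 ltW);
      try (by apply/measurable_EFinP; exact: measurable_indic).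
    by rewrite integral_indic// muleC setIC.
(* The support may leave A for its closure, hence the larger radius. *)
- exists x, (r + 1); move=> y /= suppy; rewrite ball_mdist /= ltNge; apply/negP => xy.
  have := suppy (ball y 1) (open_ball_metric y 1) (ballxx _ ltr01).
  rewrite [X in (0 < X)%E]muE (_ : _ `&` A = set0) ?measure0 ?mul0e ?ltxx//.
  rewrite -subset0 => z [+ /Ar]; rewrite !ball_mdist /= => yz xz.
  have := mdistD x z y; rewrite (mdistC z); lra.
Qed.

End uniform_distribution.

(** Of the two terms of the curvature bound only that of A1 is kept: its factor t c stays away from
    0 as t tends to 1, and the size of A0 does not enter. The last hypothesis says that S contains
    every point whose defect is below kap, so that by [W2_geodesic_null] the geodesic is carried by
    S at time t. *)
Lemma brunn_minkowski (R : realType) (K N D : R) (X : metricPType R)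
    (m : {measure set (borel X) -> \bar R}) : 1 <= N -> 0 <= D -> CDstar K N m ->
  exists c al : R, [/\ 0 < c, 0 < al <= 1 &
    forall (A0 A1 S : set (borel X)) (t kap : R),
      [/\ measurable A0, measurable A1 & measurable S] ->
      (0 < m A0 < +oo)%E -> (0 < m A1 < +oo)%E -> (m S < +oo)%E ->
      bounded_in (A0 : set X) -> bounded_in (A1 : set X) ->
      (forall x y : X, A0 x -> A1 y -> mdist x y <= D) ->
      0 < t < 1 -> 0 < kap ->
      (forall x y z : X, A0 x -> ~ S y -> A1 z ->
        mdist x z ^+ 2 + kap <=
          t^-1 * mdist x y ^+ 2 + (1 - t)^-1 * mdist y z ^+ 2) ->
      t * c * fine (m A1) `^ al <= fine (m S) `^ al].
Proof.
move=> N1 D0 [_ sX _ CD].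
have [N' [c [NN' c0 csigma]]] := sigma_lower_bound K N1 D0.
have N'1 : 1 <= N' by rewrite (le_trans N1).
have N'0 : 0 < N' by rewrite (lt_le_trans ltr01).
exists c, N'^-1; split => //; first by rewrite invr_gt0 N'0 invf_le1.
move=> A0 A1 S t kap [mA0 mA1 mS] /andP[A00 A0oo] /andP[A10 A1oo] Soo bA0 bA1 dD t01 kap0 hS.
have /andP[t0 t1] := t01.
have [mu0 [dmu0 bmu0 muA0]] := uniform_density mA0 A00 A0oo bA0.
have [mu1 [dmu1 bmu1 muA1]] := uniform_density mA1 A10 A1oo bA1.
have [q [mu [rho [[cq _] gmu dmu CDq]]]] := CD _ _ _ _ dmu0 dmu1 bmu0 bmu1.
have tI : t \in `[0, 1]%R by rewrite in_itv/= !ltW.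
have mutS : mu t (~` S) = 0%E.
  apply: (@W2_geodesic_null _ _ mu0 mu1 q mu t kap D A0 A1) => //.
  exact: measurableC.
have up := density_power_le (dmu _ tI).1 mS Soo mutS (_ : 0 < N'^-1 <= 1).
rewrite -lee_fin; apply: le_trans (up _); last by rewrite invr_gt0 N'0 invf_le1.
apply: le_trans (CDq _ tI _ NN').
have mAB := measurableX mA0 mA1.
pose r := t * c * fine (m A1) `^ N'^-1.
have r0 : 0 <= r by rewrite !mulr_ge0 ?powR_ge0 ?ltW.
apply: (@le_trans _ _ (\int[q]_z (r%:E * (\1_(A0 `*` A1) z)%:E))%E).
  rewrite ge0_integralZl_EFin//; last by apply/measurable_EFinP; exact: measurable_indic.
  rewrite integral_indic// setIT.
  have q1 : q (A0 `*` A1) = 1%E.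
    rewrite -(setCK (A0 `*` A1)) (probability_setC _ (measurableC mAB)).
    by rewrite (coupling_setX cq) ?sube0.
  by rewrite [X in (_ * X)%E]q1 mule1.
have sge s z : 0 <= s <= 1 -> (0 <= sigma K N' s (mdist (z.1 : X) (z.2 : X)))%E.
  by move=> s01; apply: sigma_ge0 => //; exact: mdist_ge0.
have t1I : 0 <= 1 - t <= 1 by rewrite subr_ge0 ltW//= lerBlDr lerDl ltW.
apply: le_integral_nonmeasurable => -[x y] /=.
  by rewrite mule_ge0// lee_fin.
rewrite indicE; case: (boolP ((x, y) \in _)) => [|_]; last first.
  rewrite mule0 adde_ge0// mule_ge0 ?lee_fin ?powR_ge0//.
  - exact: (sge _ (x, y)).
  - by apply: (sge _ (x, y)); rewrite !ltW.
rewrite inE mule1 => -[/= Ax Ay].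
rewrite -[leLHS]add0e; apply: leeD.
  by rewrite mule_ge0 ?lee_fin ?powR_ge0//; exact: (sge _ (x, y)).
rewrite /r EFinM; apply: lee_pmul.
- by rewrite lee_fin mulr_ge0 ?ltW.
- by rewrite lee_fin powR_ge0.
- by apply: csigma; [rewrite !ltW|rewrite mdist_ge0 dD].
by rewrite indicE mem_set// mulr1 powR_inv// fine_gt0// A10.
Qed.

(** * Compact subsets, and the equality case in nonbranching spaces *)

Section tightness.
Context {R : realType} {X : metricPType R}.
Implicit Types (A K : set X) (u : nat -> X).

Lemma natSinv_lt (e : R) : 0 < e -> exists k : nat, k.+1%:R^-1 < e.
Proof.
by move=> e0; have [k _ /(_ k (leqnn _))] := near_infty_natSinv_lt (PosNum e0); exists k.
Qed.

Lemma ultra_bigcup_ord (T : Type) (F : set_system T) (B : nat -> set T) (n : nat) :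
  UltraFilter F -> F (\bigcup_(i < n) B i) -> exists i, F (B i).
Proof.
move=> UF; rewrite bigcup_mkord; elim: n => [|n IH].
  by rewrite big_ord0 => /filter_not_empty.
rewrite big_ord_recr /= => FU; have [|FnB] := @in_ultra_setVsetC _ F (B n) UF.
  by exists n.
apply: IH; apply: filterS (filterI FU FnB) => x [[]//].
Qed.

(** An ultrafilter on a finite union of balls contains one of them, so it is Cauchy. *)
Lemma compact_totally_bounded A : complete_space X -> closed A ->
  (forall e : R, 0 < e -> exists u n, A `<=` \bigcup_(i < n) ball (u i) e) ->
  compact A.
Proof.
move=> cX cA tb; rewrite compact_ultra => F UF FA.
have cF : cauchy F.
  apply: cauchy_exP => e e0; have [u [n Au]] := tb e e0.
  have FU : F (\bigcup_(i < n) ball (u i) e) by apply: filterS Au FA.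
  have [i Fi] := @ultra_bigcup_ord _ F (fun i => ball (u i) e) n UF FU.
  by exists (u i).
have PF : ProperFilter F by exact: ultra_proper.
have cvgF : F --> lim F := cX F PF cF.
exists (lim F); split => //; rewrite (closure_id A).1// => B nB.
exact: filter_ex (filterI FA (cvgF B nB)).
Qed.

(** Ulam's argument: at scale 1 / (k + 1) finitely many balls cover A up to measure a / 2^(k + 2),
    so what is lost over all scales is at most half of a. *)
Lemma tight_closed (m : {measure set (borel X) -> \bar R}) A :
  complete_space X -> separable_space X -> closed A -> (0 < m A < +oo)%E ->
  exists K, [/\ compact K, K `<=` A & (0 < m K)%E].
Proof.
move=> cX sX cA /andP[mA0 mAoo]; have [u du] := dense_seqP sX.
have mA := borel_closed cA.
pose a := fine (m A); have aE : m A = a%:E by rewrite fineK// ge0_fin_numE// ltW.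
have a0 : 0 < a by rewrite fine_gt0// mA0.
have mb k i : @measurable _ (borel X) (ball (u i) (k.+1%:R^-1 : R)).
  exact: (@borel_open _ X _ (open_ball_metric _ _)).
pose C k n : set (borel X) := \bigcup_(i < n) ball (u i) (k.+1%:R^-1 : R).
have mC k n : measurable (C k n) by apply: bigcup_measurable => i _; exact: mb.
have small k : exists n, (m (A `\` C k n) <= (a / 2 / (2 ^ k.+1)%:R)%:E)%E.
  have e0 : 0 < a / 2 / (2 ^ k.+1)%:R by rewrite !divr_gt0// ltr0n expn_gt0.
  have cap0 : \bigcap_n (A `\` C k n) = set0.
    rewrite -subset0 => x h; have k0 : 0 < k.+1%:R^-1 :> R by rewrite invr_gt0.
    have [i ui] := du x _ k0.
    have /= := (h i.+1 I).2; apply; exists i => //=.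
    by rewrite ball_mdist.
  have cv : m (A `\` C k n) @[n --> \oo] --> (0 : \bar R).
    rewrite -(measure0 m) -cap0; apply: nonincreasing_cvg_mu.
    - rewrite (le_lt_trans _ mAoo)//; apply: le_measure; rewrite ?inE//.
      exact: measurableD.
    - by move=> n; exact: measurableD.
    - by rewrite cap0.
    - move=> n n' nn'; apply/subsetPset; apply: setDS.
      by move=> y [j /= jn yj]; exists j => //=; exact: leq_trans nn'.
  apply: contrapT => /forallNP h.
  have : ((a / 2 / (2 ^ k.+1)%:R)%:E <= (0 : \bar R))%E.
    apply: cvge_ge cv; apply: nearW => n; apply/ltW; rewrite ltNge; apply/negP; exact: h.
  by rewrite lee_fin leNgt e0.
have [nk nkP] := choice small.
pose K0 : set (borel X) := A `&` \bigcap_k C k (nk k).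
have mK0 : measurable K0 by apply: measurableI => //; apply: bigcap_measurable => // k _.
have K0gt0 : (0 < m K0)%E.
  have : (m (A `\` K0) <= (a / 2)%:E)%E.
    apply: le_trans (epsilon_trick0 xpredT (ltW (divr_gt0 a0 (ltr0Sn _ 1)))).
    apply: (@le_trans _ _ (\sum_(0 <= k <oo) m (A `\` C k (nk k)))%E).
      apply: measure_sigma_subadditive.
      - by move=> k; exact: measurableD.
      - exact: measurableD.
      move=> x [Ax nK]; apply: contrapT => nU; apply: nK; split => // k _.
      by apply: contrapT => nC; apply: nU; exists k.
    by apply: lee_nneseries => // k _; exact: nkP.
  move=> h; rewrite lt_def measure_ge0 andbT; apply/eqP => K00.
  have : (m A <= (a / 2)%:E)%E.
    rewrite -(setDUK (_ : K0 `<=` A)) ; last by move=> x [].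
    apply: le_trans (measureU2 _ mK0 (measurableD mA mK0)) _.
    by rewrite -[X in (X + _)%E]/(m K0) K00 add0e.
  by rewrite aE lee_fin; lra.
have K0A : K0 `<=` A by move=> x [].
have cKA : closure K0 `<=` A.
  by rewrite [X in _ `<=` X](closure_id A).1//; exact: closureS.
(* The closure stays in the closed set A, and enlarged balls around the same finitely many centres
   still cover it. *)
exists (closure (K0 : set X)); split => //.
- apply: compact_totally_bounded => //; first exact: closed_closure.
  move=> e e0; have [k ke] := natSinv_lt (divr_gt0 e0 (ltr0Sn _ 1)).
  exists u, (nk k) => x cx.
  have [y [[_ K0y]]] := cx _ (nbhsx_ballx x (e / 2) (divr_gt0 e0 (ltr0Sn _ 1))).
  have [i /= ik] := K0y k I.
  rewrite !ball_mdist /= => uy xy; exists i => //=; rewrite ball_mdist /=.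
  move: uy ke; move: (k.+1%:R^-1) => k1 uy ke.
  have := mdistD (u i) y x; rewrite (mdistC y x); lra.
- rewrite (lt_le_trans K0gt0)//; apply: le_measure; rewrite ?inE//; last exact: subset_closure.
  exact: (@borel_closed _ X _ (@closed_closure X K0)).
Qed.

(** The defect is the sum of a square over t (1 - t) and of (a + b)^2 - d^2, both nonnegative, so
    equality makes both vanish. *)
Lemma strict_split (x y z : X) (t : R) : 0 < t < 1 ->
  mdist x z ^+ 2 = t^-1 * mdist x y ^+ 2 + (1 - t)^-1 * mdist y z ^+ 2 ->
  mdist x y = t * mdist x z /\ mdist y z = (1 - t) * mdist x z.
Proof.
move=> /andP[t0 t1]; have t1' : 0 < 1 - t by rewrite subr_gt0.
have := mdistD x y z; have := mdist_ge0 x y; have := mdist_ge0 y z; have := mdist_ge0 x z.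
move: (mdist x y) (mdist y z) (mdist x z) => a b d d0 b0 a0 dab eq.
have e1 : t^-1 * a ^+ 2 + (1 - t)^-1 * b ^+ 2 - (a + b) ^+ 2 =
  ((1 - t) * a - t * b) ^+ 2 / (t * (1 - t)).
  by field; rewrite !gt_eqF.
have e2 : 0 <= ((1 - t) * a - t * b) ^+ 2 / (t * (1 - t)).
  by rewrite divr_ge0 ?sqr_ge0// mulr_ge0 ?ltW.
have e3 : d ^+ 2 <= (a + b) ^+ 2 by rewrite lerXn2r ?nnegrE ?addr_ge0.
have e4 : ((1 - t) * a - t * b) ^+ 2 / (t * (1 - t)) = 0.
  by apply/eqP; rewrite eq_le e2 andbT -e1 -eq; lra.
have e5 : (1 - t) * a - t * b = 0.
  have tt : t * (1 - t) != 0 by rewrite mulf_neq0// gt_eqF.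
  by move: e4 => /(congr1 ( *%R^~ (t * (1 - t))))/eqP; rewrite divfK// mul0r sqrf_eq0 => /eqP.
have e6 : a + b = d.
  apply/eqP; rewrite -(@eqrXn2 _ 2)// ?addr_ge0//; apply/eqP; lra.
by rewrite -e6; split; nra.
Qed.

(** Countably many small balls around a dense sequence cover X, and one of them must charge A.
    Finiteness on the doubled ball leaves room for a neighbourhood of finite measure. *)
Lemma locally_finite_charge (m : {measure set (borel X) -> \bar R}) A :
  separable_space X -> locally_finite m -> closed A -> m A != 0%E ->
  exists (c : X) (r : R), [/\ 0 < r, (m (ball c (2 * r)) < +oo)%E &
    (0 < m (A `&` [set y | (mdist c y <= r)%R]))%E].
Proof.
move=> sX fm cA mA0; have [u du] := dense_seqP sX.
have mA := borel_closed cA.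
have mc c r : @measurable _ (borel X) [set y | mdist c y <= r].
  apply: borel_closed; rewrite (_ : [set _ | _] = mdist c @^-1` [set r' | r' <= r])//.
  by apply: preimage_closed; [move=> ? _; exact: mdistr_continuous|exact: closed_le].
apply: contrapT => nex; move/eqP: mA0; apply.
apply: (iffLR (negligibleP m mA)).
pose F n k : set (borel X) :=
  if (m (ball (u n) (2 * k.+1%:R^-1 : R)) < +oo)%E
  then A `&` [set y | mdist (u n) y <= k.+1%:R^-1] else set0.
have NF n k : m.-negligible (F n k).
  rewrite /F; case: ifPn => [fin|_]; last exact: negligible_set0.
  have mAc := measurableI _ _ mA (mc (u n) k.+1%:R^-1).
  apply: (iffRL (negligibleP m mAc)); apply: contrapT => /eqP nz; apply: nex.
  exists (u n), k.+1%:R^-1; split => //.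
  by rewrite lt_def nz measure_ge0.
have : m.-negligible (\bigcup_n \bigcup_k F n k).
  by apply: negligible_bigcup => n; exact: negligible_bigcup.
apply: negligibleS.
move=> x Ax; have [U [oU Ux mU]] := fm x.
have /nbhs_mdistP[e e0 eU] : nbhs x U by exact: open_nbhs_nbhs.
(* The ball of radius 2 / (k + 1) around [u n] lies within 3 / (k + 1) < e of x. *)
have e30 : 0 < e / 3 by rewrite divr_gt0.
have [k ke] := natSinv_lt e30.
have k0 : 0 < k.+1%:R^-1 :> R by rewrite invr_gt0.
have [n un] := du x _ k0.
exists n => //; exists k => //; rewrite /F ifT.
  by split => //=; exact: ltW.
apply: le_lt_trans mU; apply: le_measure; rewrite ?inE.
- exact: (@borel_open _ X _ (open_ball_metric _ _)).
- exact: (@borel_open _ X _ oU).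
move=> y; rewrite ball_mdist /= => uy; apply: eU.
have := mdistD x (u n) y; rewrite (mdistC x (u n)); move: ke k0 un uy.
by move: (k.+1%:R^-1) => k1; lra.
Qed.

Lemma bisector_strict (p q x y : X) (t : R) : nonbranching X -> p <> q ->
  0 < t < 1 -> mdist p x = mdist q x -> mdist p y = mdist q y ->
  mdist p x ^+ 2 < t^-1 * mdist p y ^+ 2 + (1 - t)^-1 * mdist y x ^+ 2.
Proof.
move=> [_ nb] pq t01 Ex Ey; have /andP[t0 t1] := t01.
rewrite lt_neqAle mdist_sqr_split// andbT; apply/eqP => eq.
have [py yx] := strict_split t01 eq.
have px : p <> x.
  move=> px; apply: pq; rewrite px in Ex *; apply/esym/mdist_positivity.
  by rewrite -Ex mdist0.
have px0 := mdist_pos px.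
have py0 : 0 < mdist p y by rewrite py mulr_gt0.
have yx0 : 0 < mdist y x by rewrite yx mulr_gt0// subr_gt0.
(* The branching is seen from x: its geodesics to p and q share the part up to y, and [Ey] gives the
   equal lengths beyond y that [nonbranching] asks for. *)
apply: nb; exists x, y, p, q; rewrite !(mdistC x) !(mdistC y p) !(mdistC y q) -?Ex -?Ey; split => //.
- rewrite /= !inE !negb_or -!mdist_gt0 (mdistC x y) yx0 (mdistC x p) px0.
  rewrite (mdistC x q) -Ex px0 (mdistC y p) py0 (mdistC y q) -Ey py0 /=.
  by rewrite andbT mdist_gt0; apply/eqP.
- by rewrite py yx; ring.
- by rewrite py yx; ring.
Qed.

Lemma compact_nbhd_measure (m : {measure set (borel X) -> \bar R}) K (rho a : R) :
  closed K -> 0 < rho -> (m [set y | exists2 x, K x & (mdist x y < rho)%R] < +oo)%E ->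
  (m K < a%:E)%E -> exists e : R, [/\ 0 < e, e <= rho &
    (m [set y | exists2 x, K x & (mdist x y < e)%R] < a%:E)%E].
Proof.
move=> cK rho0 Uoo mKa.
pose U (e : R) : set (borel X) := [set y | exists2 x, K x & mdist x y < e].
have oU e : open (U e : set X).
  rewrite (_ : U e = \bigcup_(x in K) ball x e).
    by apply: bigcup_open => x _; exact: open_ball_metric.
  by apply/seteqP; split => y [x Kx]; [move=> xy; exists x|]; rewrite ?ball_mdist//; exists x.
have mU e : measurable (U e) by exact: (@borel_open _ X _ (oU e)).
pose d (j : nat) : R := rho / j.+1%:R.
have d0 j : 0 < d j by rewrite divr_gt0.
have capU : \bigcap_j U (d j) = K.
  apply/seteqP; split => [y Uy|y Ky j _]; last by exists y => //; rewrite mdist0.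
  rewrite (closure_id K).1// => B /nbhs_mdistP[e e0 eB].
  have er : 0 < e / rho by rewrite divr_gt0.
  have [j je] := natSinv_lt er.
  have [x Kx xy] := Uy j I; exists x; split => //; apply: eB.
  rewrite mdistC (lt_trans xy)// /d mulrC -ltr_pdivlMr//.
have cv : m (U (d j)) @[j --> \oo] --> m K.
  rewrite -capU; apply: nonincreasing_cvg_mu => //.
  - rewrite (le_lt_trans _ Uoo)//; apply: le_measure; rewrite ?inE//; first exact: mU.
    by move=> y [x Kx xy]; exists x => //; rewrite (lt_le_trans xy)// /d divr1.
  - by rewrite capU; exact: borel_closed.
  - move=> i j ij; apply/subsetPset => y [x Kx xy]; exists x => //.
    by rewrite (lt_le_trans xy)// ler_pM2l// lef_pV2 ?posrE// ler_nat.
apply: contrapT => /forallNP nex.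
have : (a%:E <= m K)%E.
  apply: cvge_ge cv; apply: nearW => j; rewrite leNgt; apply/negP => Ua.
  apply: (nex (d j)); split => //.
  by rewrite ler_pdivrMr// ler_peMr ?ler1n// ltW.
by rewrite leNgt mKa.
Qed.

End tightness.

Lemma sqr_le_shift (R : realType) (a b d D : R) : 0 <= a -> 0 <= b -> 0 <= d ->
  d <= 1 -> 1 <= D -> a <= b + d -> b <= D -> a ^+ 2 <= b ^+ 2 + 3 * D * d.
Proof.
move=> a0 b0 d0 d1 D1 abd bD.
apply: (@le_trans _ _ ((b + d) ^+ 2)); first by rewrite lerXn2r ?nnegrE ?addr_ge0.
have h1 : b * d <= D * d by rewrite ler_wpM2r.
have h2 : d * d <= D * d by rewrite ler_wpM2r// (le_trans d1).
nra.
Qed.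

(** Moving the starting point from p to x changes each of its two squared distances by at most 3 D
    d, and one of them carries t^-1 <= 2, whence 9. The term with (1 - t)^-1, which is large for t
    near 1, does not involve the starting point. *)
Lemma midpoint_shift (R : realType) (X : metricPType R) (p x y z : X) (t d D : R) :
  1 <= D -> 2^-1 <= t -> mdist p x <= d -> d <= 1 ->
  mdist p y <= D - 1 -> mdist p z <= D - 1 ->
  t^-1 * mdist p y ^+ 2 + (1 - t)^-1 * mdist y z ^+ 2 - mdist p z ^+ 2 <=
  t^-1 * mdist x y ^+ 2 + (1 - t)^-1 * mdist y z ^+ 2 - mdist x z ^+ 2 + 9 * D * d.
Proof.
move=> D1 t2 pxd d1 pyD pzD.
have d0 : 0 <= d by rewrite (le_trans (mdist_ge0 p x)).
have t0 : 0 < t by rewrite (lt_le_trans _ t2) ?invr_gt0.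
have ti2 : t^-1 <= 2 by rewrite -(invrK 2) lef_pV2 ?posrE ?invr_gt0.
have sq1 : mdist p y ^+ 2 <= mdist x y ^+ 2 + 3 * D * d.
  have h1 := mdistD p x y; have h2 := mdistD x p y; rewrite (mdistC x p) in h2.
  by apply: sqr_le_shift; rewrite ?mdist_ge0//; lra.
have sq2 : mdist x z ^+ 2 <= mdist p z ^+ 2 + 3 * D * d.
  have h1 := mdistD x p z; rewrite (mdistC x p) in h1.
  by apply: sqr_le_shift; rewrite ?mdist_ge0//; lra.
have Dd : 0 <= D * d by rewrite mulr_ge0// (le_trans ler01).
have sq3 : t^-1 * mdist p y ^+ 2 <= t^-1 * (mdist x y ^+ 2 + 3 * D * d).
  by rewrite ler_pM2l ?invr_gt0.
have sq4 : t^-1 * (D * d) <= 2 * (D * d) by rewrite ler_wpM2r.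
lra.
Qed.

(** * Bisectors are null sets *)

Section bisector.
Context {R : realType} (K N : R) (N_ge1 : 1 <= N) (X : metricPType R).
Variable m : {measure set (borel X) -> \bar R}.
Hypotheses (X_nonbranching : nonbranching X) (X_CDstar : CDstar K N m).
Hypothesis supp_m : measure_support m = [set: X].

Lemma bisector_null (p q : X) : p <> q ->
  m [set x : X | mdist p x = mdist q x] = 0%E.
Proof.
move=> pq; pose E : set X := [set x : X | mdist p x = mdist q x].
have [cX sX fm _] := X_CDstar.
have closedE_le (c : X) (r : R) : closed [set y | mdist c y <= r].
  rewrite (_ : [set _ | _] = mdist c @^-1` [set r' | r' <= r])//.
  by apply: preimage_closed; [move=> ? _; exact: mdistr_continuous|exact: closed_le].
have cE : closed E.
  rewrite (_ : E = (fun x => mdist p x - mdist q x) @^-1` [set 0]).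
    apply: preimage_closed; last exact: closed_eq.
    by move=> x _; apply: cvgB; exact: mdistr_continuous.
  by apply/seteqP; split => x /= /eqP; rewrite ?subr_eq0 => h; apply/eqP; rewrite ?subr_eq0.
apply/eqP; apply: contrapT => /negP mE.
have [c [rho [rho0 c2oo cpos]]] := locally_finite_charge sX fm cE mE.
pose F := E `&` [set y | mdist c y <= rho].
have cF : closed F by apply: closedI.
have subc (A : set (borel X)) : measurable A ->
    (forall y : X, A y -> mdist c y < 2 * rho) -> (m A < +oo)%E.
  move=> mA Ac; apply: le_lt_trans c2oo; apply: le_measure; rewrite ?inE//.
    exact: (@borel_open _ X _ (open_ball_metric _ _)).
  by move=> y Ay; rewrite ball_mdist; exact: Ac.
have Foo : (m F < +oo)%E.
  apply: subc; first exact: borel_closed.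
  by move=> y [_ /= cy]; rewrite (le_lt_trans cy)// ltr_pMl// ltr1n.
have [C [compC CF C0]] := tight_closed cX sX cF (introT andP (conj cpos Foo)).
have closedC : closed C by apply: compact_closed => //; exact: metric_hausdorff.
have mC : @measurable _ (borel X) C by exact: borel_closed.
have Coo : (m C < +oo)%E.
  by apply: le_lt_trans Foo; apply: le_measure; rewrite ?inE//; exact: borel_closed.
have [U0 [oU0 U0p U0oo]] := fm p.
have /nbhs_mdistP[del0 del00 del0U] : nbhs p U0 by exact: open_nbhs_nbhs.
(* The summand 1 is room for the ball around p, whose radius will be at most 1. *)
pose D := 1 + mdist p c + rho.
have D0 : 0 <= D by rewrite !addr_ge0 ?mdist_ge0// ltW.
have pD x : C x -> mdist p x <= D - 1.
  by move=> /CF[_ /= cx]; have := mdistD p c x; rewrite /D; lra.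
have [k [al [k0 /andP[al0 al1] BM]]] := brunn_minkowski N_ge1 D0 X_CDstar.
pose mCr := fine (m C).
have mCE : m C = mCr%:E by rewrite /mCr fineK// ge0_fin_numE.
have mCr0 : 0 < mCr by rewrite fine_gt0// C0.
(* This is the lower bound for m S that the Brunn-Minkowski inequality gives for every t >= 1/2. It
   is fixed before t, so that a neighbourhood of C with less excess measure than [eta] can dictate
   t. *)
pose eta := (k / 2 * mCr `^ al) `^ al^-1.
have eta0 : 0 < eta by rewrite powR_gt0// mulr_gt0 ?divr_gt0// powR_gt0.
have [e [e0 erho Ue]] : exists e : R, [/\ 0 < e, e <= rho &
    (m [set y | exists2 x, C x & (mdist x y < e)%R] < (mCr + eta)%:E)%E].
  apply: compact_nbhd_measure => //; last by rewrite mCE lte_fin ltrDl.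
  apply: subc.
    apply: borel_open; rewrite (_ : [set _ | _] = \bigcup_(x in C) ball x rho).
      by apply: bigcup_open => x _; exact: open_ball_metric.
    by apply/seteqP; split => y [x Kx]; [move=> xy; exists x|]; rewrite ?ball_mdist//; exists x.
  by move=> y [x /CF[_ /= cx] xy]; have := mdistD c x y; lra.
have D21 : 0 < D ^+ 2 + 1 by rewrite ltr_wpDl ?sqr_ge0.
(* A point y of S with partner z in C satisfies (1 - t)^-1 d(y, z)^2 < D^2 + 1, as kap <= 1; this
   choice of t makes d(y, z) < e. *)
pose t := 1 - Num.min 2^-1 (e ^+ 2 / (D ^+ 2 + 1)).
have t'0 : 0 < 1 - t by rewrite /t opprB addrC subrK lt_min invr_gt0 ltr0n divr_gt0 ?exprn_gt0.
have t2 : 2^-1 <= t.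
  have : 1 - t <= 2^-1 by rewrite /t opprB addrC subrK ge_min lexx.
  lra.
have te : (1 - t) * (D ^+ 2 + 1) <= e ^+ 2.
  by rewrite -ler_pdivlMr// /t opprB addrC subrK ge_min lexx orbT.
have t01 : 0 < t < 1.
  by rewrite (lt_le_trans _ t2) ?invr_gt0//= -subr_gt0.
have /andP[t0 t1] := t01.
(* The defect for the starting point p itself. Its minimum [kap0] on the compact C x C is positive
   by [bisector_strict]. *)
pose h (z : X * X) :=
  t^-1 * mdist p z.1 ^+ 2 + (1 - t)^-1 * mdist z.1 z.2 ^+ 2 - mdist p z.2 ^+ 2.
have hcont : continuous h.
  have cp1 : continuous (fun z : X * X => mdist p z.1).
    move=> z; apply: (@continuous_comp _ _ _ fst (mdist p)); first exact: cvg_fst.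
    exact: mdistr_continuous.
  have cp2 : continuous (fun z : X * X => mdist p z.2).
    move=> z; apply: (@continuous_comp _ _ _ snd (mdist p)); first exact: cvg_snd.
    exact: mdistr_continuous.
  have sqc (f : X * X -> R) : continuous f -> continuous (fun z => f z ^+ 2).
    move=> cf z; apply: (@continuous_comp _ _ _ f (fun r => r ^+ 2)).
      exact: cf.
    exact: exprn_continuous.
  move=> z; apply: cvgB; last exact: (sqc _ cp2).
  by apply: cvgD; apply: cvgM; [exact: cvg_cst|exact: (sqc _ cp1)|exact: cvg_cst|
    exact: (sqc _ (@mdist_continuous R X))].
have C_ne : C !=set0.
  apply/set0P/eqP => C_e; move: C0; rewrite C_e measure0 ltxx//.
have [[y0 x0]] : exists2 z, z \in C `*` C & forall z', z' \in C `*` C -> h z <= h z'.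
  apply: compact_EVT_min.
  - by have [x Cx] := C_ne; exists (x, x).
  - exact: compact_setX.
  - exact: continuous_subspaceT.
rewrite inE => -[/= Cy0 Cx0] hmin.
have h0 : 0 < h (y0, x0).
  rewrite subr_gt0; apply: bisector_strict X_nonbranching pq t01 _ _.
  - exact: (CF _ Cx0).1.
  - exact: (CF _ Cy0).1.
set kap0 := h (y0, x0) in h0 hmin.
pose kap := Num.min 1 (kap0 / 2).
have kap_gt0 : 0 < kap by rewrite lt_min ltr01 divr_gt0.
(* Half of [kap0] is spent on [kap]; this bound keeps the error 9 D del of [midpoint_shift] below
   the other half, and [del0] makes the measure of the ball finite. *)
pose del := Num.min (Num.min 1 del0) (kap0 / (24 * D + 1)).
have D24 : 0 < 24 * D + 1 by rewrite ltr_wpDl// mulr_ge0.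
have del_gt0 : 0 < del by rewrite !lt_min ltr01 del00 divr_gt0.
have del1 : del <= 1 by rewrite /del !ge_min lexx.
have deld : del <= del0 by rewrite /del !ge_min lexx orbT.
have delk : del * (24 * D + 1) <= kap0.
  by rewrite -ler_pdivlMr// /del !ge_min lexx !orbT.
pose A0 : set (borel X) := ball p del.
pose S : set (borel X) := [set y | exists x z, [/\ A0 x, C z &
  t^-1 * mdist x y ^+ 2 + (1 - t)^-1 * mdist y z ^+ 2 < mdist x z ^+ 2 + kap]].
have oS : open (S : set X).
  rewrite (_ : S = \bigcup_(x in A0) \bigcup_(z in C) ((fun y =>
      t^-1 * mdist x y ^+ 2 + (1 - t)^-1 * mdist z y ^+ 2) @^-1`
      [set r | r < mdist x z ^+ 2 + kap])); last first.
    apply/seteqP; split => y.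
      by move=> [x [z [Ax Cz H]]]; exists x => //; exists z => //=; rewrite (mdistC z).
    by move=> [x Ax [z Cz H]]; exists x, z; split => //; rewrite (mdistC y).
  apply: bigcup_open => x _; apply: bigcup_open => z _; apply: open_comp; last exact: open_lt.
  have sqd (w : X) : continuous (fun y => mdist w y ^+ 2).
    move=> y; apply: (@continuous_comp _ _ _ (mdist w) (fun r => r ^+ 2)).
      exact: mdistr_continuous.
    exact: exprn_continuous.
  by move=> y _; apply: cvgD; apply: cvgM; [exact: cvg_cst|exact: sqd|exact: cvg_cst|exact: sqd].
have mS : measurable S by exact: (@borel_open _ X _ oS).
have A0D (x z : X) : A0 x -> C z -> mdist x z <= D.
  rewrite /A0 ball_mdist /= => px /pD; have := mdistD x p z; rewrite (mdistC x p); lra.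
have SU : S `<=` [set y | exists2 x, C x & mdist x y < e].
  move=> y [x [z [Ax Cz H]]]; exists z => //.
  rewrite -(@ltr_pXn2r _ 2)// ?nnegrE ?mdist_ge0 ?ltW//; apply: lt_le_trans te.
  rewrite mulrC -ltr_pdivrMr// mulrC mdistC.
  have xz : mdist x z ^+ 2 <= D ^+ 2.
    by rewrite lerXn2r ?nnegrE ?mdist_ge0// A0D.
  have kap1 : kap <= 1 by rewrite /kap ge_min lexx.
  have xy : 0 <= t^-1 * mdist x y ^+ 2 by rewrite mulr_ge0 ?sqr_ge0// invr_ge0 ltW.
  by clear -H xz kap1 xy; lra.
have SC y : S y -> C y -> False.
  move=> [x [z [Ax Cz H]]] Cy.
  have kapk : kap <= kap0 / 2 by rewrite /kap ge_min lexx orbT.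
  have hyz := hmin (y, z) (mem_set (conj Cy Cz)); rewrite /h /= in hyz.
  move: Ax; rewrite /A0 ball_mdist /= => px.
  have D1 : 1 <= D by rewrite /D -addrA lerDl addr_ge0 ?mdist_ge0 ?ltW.
  have := midpoint_shift D1 t2 (ltW px) del1 (pD _ Cy) (pD _ Cz).
  have Dd : 0 <= D * del by rewrite mulr_ge0// ltW.
  move=> shift; suff : kap0 < kap0 by rewrite ltxx.
  by clear -shift Dd hyz H kapk delk del_gt0; lra.
have USC : (m S + m C <= m [set y | exists2 x, C x & (mdist x y < e)%R])%E.
  rewrite -measureU//; last by rewrite -subset0 => y [/SC].
  apply: le_measure; rewrite ?inE//; first exact: measurableU.
    apply: borel_open; rewrite (_ : [set _ | _] = \bigcup_(x in C) ball x e).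
      by apply: bigcup_open => x _; exact: open_ball_metric.
    by apply/seteqP; split => y [x Kx]; [move=> xy; exists x|]; rewrite ?ball_mdist//; exists x.
  by move=> y [/SU//|Cy]; exists y => //; rewrite mdist0.
have Soo : (m S < +oo)%E.
  rewrite (le_lt_trans _ (ltry (mCr + eta)))// (le_trans _ (ltW Ue))//.
  by rewrite (le_trans _ USC)// leeDl.
have mSE : m S = (fine (m S))%:E by rewrite fineK// ge0_fin_numE.
have mA0 : measurable A0 by exact: (@borel_open _ X _ (open_ball_metric _ _)).
have A00 : (0 < m A0 < +oo)%E.
  apply/andP; split.
    have : measure_support m p by rewrite supp_m.
    by apply; [exact: open_ball_metric|exact: ballxx].
  apply: le_lt_trans U0oo; apply: le_measure; rewrite ?inE//.
    exact: (@borel_open _ X _ oU0).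
  by move=> x; rewrite /A0 ball_mdist /= => px; apply: del0U; exact: lt_le_trans deld.
have bA0 : bounded_in (A0 : set X) by exists p, del.
have bC : bounded_in C.
  by exists p, D => x /pD; rewrite ball_mdist => h1; rewrite /= (le_lt_trans h1)// gtrBl.
have key := BM A0 C S t kap (And3 mA0 mC mS) A00 (introT andP (conj C0 Coo)) Soo bA0 bC
  A0D t01 kap_gt0.
have etaS : eta <= fine (m S).
  have alV : al * al^-1 = 1 by rewrite mulfV// gt_eqF.
  have -> : fine (m S) = (fine (m S) `^ al) `^ al^-1.
    by rewrite -powRrM alV powRr1// fine_ge0.
  have al_ge0 : 0 <= al^-1 by rewrite invr_ge0 ltW.
  have lhs_ge0 : 0 <= k / 2 * mCr `^ al by rewrite mulr_ge0 ?powR_ge0// divr_ge0// ltW.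
  apply: ge0_ler_powR; rewrite ?nnegrE ?powR_ge0//.
  apply: le_trans (key _); last first.
    move=> x y z Ax nS Cz; rewrite leNgt; apply/negP => H; apply: nS.
    by exists x, z.
  by rewrite ler_wpM2r ?powR_ge0// mulrC ler_wpM2r// ltW.
by move: (le_lt_trans USC Ue); rewrite mSE mCE -EFinD lte_fin; clear -etaS; lra.
Qed.

End bisector.

(** * Geodesics, the lifted distance and lifting of points *)

Section curves.
Context {R : realType} {X : metricPType R}.

Lemma mdist_le_curve_length (gamma : R -> X) :
  ((mdist (gamma 0) (gamma 1))%:E <= curve_length gamma)%E.
Proof.
apply: ereal_sup_ubound; exists [:: 1]; first exact: itv_partition1.
by rewrite /curve_variation /= big_nat1.
Qed.

Lemma curve_length_geodesic_le (gamma : R -> X) (l : R) :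
  {in `[0, 1]%R &, forall s t, mdist (gamma s) (gamma t) = `|s - t| * l} ->
  (curve_length gamma <= l%:E)%E.
Proof.
move=> gl; apply: ge_ereal_sup => _ [s ps <-]; rewrite lee_fin.
pose p n := nth 1 (0 :: s) n.
have pI n : (n < (size s).+1)%N -> p n \in `[0, 1]%R.
  by move=> ns; rewrite in_itv /= (itv_partition_nth_ge ns ps) (itv_partition_nth_le ns ps).
have pD n : (n < size s)%N -> p n <= p n.+1.
  exact: (@nondecreasing_fun_itv_partition _ _ 0 1 id s).
rewrite (_ : curve_variation _ _ = \sum_(0 <= n < size s) (p n.+1 - p n) * l).
  rewrite -mulr_suml telescope_sumr// /p (itv_partition_nth_size _ ps)/=.
  by rewrite subr0 mul1r.
apply: eq_big_nat => n /andP[_ ns] /=.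
have I1 := pI n (leqW ns); have I2 := pI n.+1 ns; rewrite (gl _ _ I1 I2).
by rewrite distrC ger0_norm// subr_ge0 pD.
Qed.

(* The geodesic is extended to the whole line by constants, so that it can be
   composed with maps that are only defined near its image. *)
Lemma geodesic_extension (x y : X) : geodesic_space X ->
  exists gamma : R -> X, [/\ gamma 0 = x, gamma 1 = y, continuous gamma,
    {in `[0, 1]%R &, forall s t,
      mdist (gamma s) (gamma t) = `|s - t| * mdist x y} &
    forall s, mdist x (gamma s) <= mdist x y].
Proof.
move=> gX; have [g [g0 g1 gd]] := gX x y.
pose c (t : R) := Num.max 0 (Num.min 1 t).
have cI t : c t \in `[0, 1]%R.
  by rewrite in_itv /= /c le_max lexx /= ge_max ler01 ge_min lexx.
have cE t : t \in `[0, 1]%R -> c t = t.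
  by rewrite in_itv /= /c => /andP[t0 t1]; rewrite (min_idPr t1) (max_idPr t0).
have clip s t : `|c s - c t| <= `|s - t|.
  have cases r : [\/ c r = 0 /\ r <= 0, c r = 1 /\ 1 <= r | c r = r].
    have [r0|r0] := lerP r 0.
      by constructor 1; rewrite /c (min_idPr _) ?(max_idPl _)// (le_trans r0).
    have [r1|r1] := lerP 1 r.
      by constructor 2; rewrite /c (min_idPl _)// (max_idPr _)// ler01.
    by constructor 3; rewrite /c (min_idPr (ltW r1)) (max_idPr (ltW r0)).
  have h1 := ler_norm (s - t); have h2 := ler_norm (t - s); rewrite distrC in h2.
  have := cI s; have := cI t; rewrite !in_itv /= => /andP[t0 t1] /andP[s0 s1].
  rewrite ler_norml; apply/andP.
  by case: (cases s) => [[cs ?]|[cs ?]|cs]; case: (cases t) => [[ct ?]|[ct ?]|ct];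
    rewrite cs ct in s0 s1 t0 t1 *; split; lra.
exists (g \o c); split => /=.
- by rewrite cE// in_itv /= lexx ler01.
- by rewrite cE// in_itv /= lexx ler01.
- move=> t B /nbhs_mdistP[e e0 eB].
  have l1 : 0 < mdist x y + 1 by rewrite ltr_wpDl ?mdist_ge0.
  have el : 0 < e / (mdist x y + 1) by rewrite divr_gt0.
  exists (e / (mdist x y + 1)) => //= s /= st; apply: eB => /=.
  rewrite gd//; apply: le_lt_trans (_ : `|t - s| * (mdist x y + 1) < e).
    by rewrite ler_pM ?mdist_ge0// lerDl.
  by rewrite -ltr_pdivlMr.
- by move=> s t sI tI /=; rewrite gd// !cE.
- move=> s /=; have csI := cI s.
  have zI : (0 : R) \in `[0, 1]%R by rewrite in_itv /= lexx ler01.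
  have := csI; rewrite in_itv /= => /andP[cs0 cs1].
  by rewrite -{1}g0 gd// sub0r normrN ger0_norm// ler_piMl ?mdist_ge0.
Qed.

End curves.

Section lifted_distance.
Context {R : realType} {Y Z : metricPType R} (f : Y -> Z).
Hypothesis lift_f : is_lift_dist f.

Lemma lift_dist_ge (a b : Y) : mdist (f a) (f b) <= mdist a b.
Proof.
rewrite -lee_fin lift_f; apply: le_ereal_inf_tmp => _ [gamma [_ g0 g1] <-].
rewrite -g0 -g1; exact: mdist_le_curve_length.
Qed.

Lemma lift_dist_le_curve (a b : Y) (gamma : R -> Y) (l : R) :
  continuous gamma -> gamma 0 = a -> gamma 1 = b ->
  {in `[0, 1]%R &, forall s t,
     mdist (f (gamma s)) (f (gamma t)) = `|s - t| * l} -> mdist a b <= l.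
Proof.
move=> cg g0 g1 gl; rewrite -lee_fin lift_f.
apply: (@le_trans _ _ (curve_length (f \o gamma))); last exact: curve_length_geodesic_le.
apply: ereal_inf_lbound; exists gamma => //; split => //.
exact: continuous_subspaceT.
Qed.

(** A curve and its image under g have the same projection, hence the same length. *)
Lemma lift_dist_lipschitz (g : Y -> Y) : continuous g -> f \o g = f ->
  forall a b, mdist (g a) (g b) <= mdist a b.
Proof.
move=> cg fg a b; rewrite -lee_fin lift_f [leRHS]lift_f.
apply: le_ereal_inf_tmp => _ [gamma [cgam g0 g1] <-].
apply: ereal_inf_lbound; exists (g \o gamma); last by rewrite compA fg.
split; rewrite /= ?g0 ?g1//.
by apply: within_continuous_comp => // x _; exact: cg.
Qed.

Lemma deckP (g : Y -> Y) : deck f g ->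
  exists h, [/\ continuous g, continuous h, cancel g h, cancel h g &
    f \o g = f /\ f \o h = f].
Proof.
move=> [[[_ _ sg] cg [h ch gh]] fg].
have ghK : cancel g h by move=> x; apply: gh; rewrite inE.
have hgK : cancel h g.
  by move=> y; have [x _ <-] := sg y I; rewrite ghK.
have cT (k : Y -> Y) : {within [set: Y], continuous k} -> continuous k.
  rewrite continuous_open_subspace; last exact: openT.
  by move=> ck x; apply: ck; rewrite inE.
exists h; split; [exact: cT|exact: cT|by []|by []|split => //].
by rewrite -{1}fg -compA; apply/funext => y /=; rewrite hgK.
Qed.

Lemma deck_isometry (g : Y -> Y) : deck f g ->
  forall a b, mdist (g a) (g b) = mdist a b.
Proof.
move=> /deckP[h [cg ch gh hg [fg fh]]] a b; apply/eqP; rewrite eq_le.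
rewrite lift_dist_lipschitz//= -{1}(gh a) -{1}(gh b).
exact: lift_dist_lipschitz.
Qed.

Hypothesis geo_Z : geodesic_space Z.
Hypothesis cov_f : covering_map f.

(** A geodesic between points within e3 / 3 of z stays within e3 of z, thus in an evenly covered
    set, and the inverse of the sheet lifts it with its length. The radius depends on z only and not
    on the point a above, which is what lets [lift_point] pass a supremum. *)
Lemma local_lift (z : Z) : exists2 e : R, 0 < e & forall a, mdist z (f a) < e ->
  (exists V : set Y, [/\ open V, V a & isometry_on V f]) /\
  forall y, mdist z y < e -> exists2 b, f b = y & mdist a b <= mdist (f a) y.
Proof.
have [cf _ evf] := cov_f.
have [U [oU Uz [S [SV _ fU]]]] := evf z.
have /nbhs_mdistP[e3 e30 e3U] : nbhs z U by exact: open_nbhs_nbhs.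
exists (e3 / 3); first by rewrite divr_gt0.
move=> a za; have Ua : U (f a) by apply: e3U; rewrite (lt_le_trans za)//; lra.
have [V SVV Va] : (\bigcup_(V in S) V) a by rewrite -fU.
have [oV [[VU _ surjV] _ [g cg gK]]] := SV V SVV.
have gV y : U y -> V (g y) /\ f (g y) = y.
  by move=> /surjV[v Vv <-]; rewrite gK ?inE.
have cgU : {in U, continuous g} by rewrite -continuous_open_subspace.
have short b c : V b -> V c -> mdist z (f b) < e3 / 3 -> mdist z (f c) < e3 / 3 ->
    mdist b c <= mdist (f b) (f c).
  move=> Vb Vc zb zc; have [gam [g0 g1 cgam gd gle]] := geodesic_extension (f b) (f c) geo_Z.
  have gamU s : U (gam s).
    apply: e3U; have := gle s; have := mdistD z (f b) (gam s).
    have := mdistD (f b) z (f c); rewrite (mdistC (f b) z); lra.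
  apply: (@lift_dist_le_curve _ _ (g \o gam)) => /=.
  - by move=> s; apply: continuous_comp; [exact: cgam|apply: cgU; rewrite inE].
  - by rewrite g0 gK ?inE.
  - by rewrite g1 gK ?inE.
  - by move=> s t sI tI; rewrite !(gV _ (gamU _)).2 gd.
split.
  exists (V `&` f @^-1` ball z (e3 / 3)); split.
  - apply: openI => //; apply: open_comp => //; exact: open_ball_metric.
  - by split => //=; rewrite ball_mdist.
  - move=> b c [Vb zb] [Vc zc]; rewrite /= ball_mdist /= in zb zc.
    by apply/eqP; rewrite eq_le lift_dist_ge short.
move=> y zy; have Uy : U y by apply: e3U; rewrite (lt_le_trans zy)//; lra.
have [Vgy fgy] := gV y Uy; exists (g y) => //.
by rewrite -{2}fgy short// fgy.
Qed.

Lemma isometric_nbhd (a : Y) : exists V, [/\ open V, V a & isometry_on V f].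
Proof.
have [e e0 H] := local_lift (f a).
by have [|] := H a; first by rewrite mdist0.
Qed.

(** A continuity argument along a geodesic from f a to y. No lifted path is built: [T] records the
    times s above which some point lies within s d of a. *)
Lemma lift_point (a : Y) (y : Z) : exists2 b, f b = y & mdist a b <= mdist (f a) y.
Proof.
have [gam [g0 g1 cgam gd _]] := geodesic_extension (f a) y geo_Z.
set d := mdist (f a) y in gd *; have d0 : 0 <= d by exact: mdist_ge0.
pose T := [set s : R | 0 <= s <= 1 /\ exists2 b, f b = gam s & mdist a b <= s * d].
have T0 : T 0 by split; [rewrite lexx ler01|exists a; rewrite ?mdist0 ?mul0r].
have supT : has_sup T by split; [exists 0|exists 1 => s [/andP[]]].
have ubT s : T s -> s <= sup T by apply: ub_le_sup; exact: supT.2.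
have s01 : 0 <= sup T <= 1.
  by rewrite ubT//= ge_sup//; [exists 0|move=> s [/andP[]]].
have [e e0 H] := local_lift (gam (sup T)).
pose eta := e / (d + 1).
have d1 : 0 < d + 1 by rewrite ltr_wpDl.
have eta0 : 0 < eta by rewrite divr_gt0.
have near s : 0 <= s <= 1 -> `|sup T - s| < eta -> mdist (gam (sup T)) (gam s) < e.
  move=> sI; rewrite gd ?in_itv//= ltr_pdivlMr// => h; apply: le_lt_trans h.
  by rewrite ler_wpM2l// lerDl.
have [s Ts sT] := sup_adherent eta0 supT.
have [sI [b fb ab]] := Ts; have ssup := ubT s Ts.
(* This time exceeds [sup T] unless it is 1; as it also belongs to [T], it is 1. *)
pose s' := Num.min 1 (sup T + eta / 2).
have s'sup : sup T <= s'.
  by rewrite le_min lerDl divr_ge0 ?(ltW eta0)// andbT; case/andP: s01.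
have s'I : 0 <= s' <= 1 by rewrite ge_min lexx /= andbT (le_trans _ s'sup)//; case/andP: s01.
have s'eta : s' <= sup T + eta / 2 by rewrite ge_min lexx orbT.
have zb : mdist (gam (sup T)) (f b) < e.
  by rewrite fb near// ger0_norm ?subr_ge0//; lra.
have [_ /(_ (gam s'))[]] := H b zb.
  by apply: near => //; rewrite distrC ger0_norm ?subr_ge0//; lra.
move=> b' fb' bb'.
have Ts' : T s'.
  split => //; exists b' => //; apply: (le_trans (mdistD a b b')).
  apply: (le_trans (lerD ab bb')); rewrite fb gd ?in_itv//= distrC ger0_norm; last first.
    by rewrite subr_ge0 (le_trans ssup).
  by rewrite -mulrDl addrC subrK.
have s'1 : s' = 1.
  have := ubT _ Ts'; rewrite /s' /Num.min; case: ifPn => // _; lra.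
move: Ts'; rewrite s'1 => -[_ [b2 fb2 ab2]]; exists b2; first by rewrite fb2.
by rewrite mul1r in ab2.
Qed.

End lifted_distance.

(** * Separability of connected, locally separable spaces *)

Lemma natSinv_gt0 (R : realType) (k : nat) : 0 < k.+1%:R^-1 :> R.
Proof. by rewrite invr_gt0. Qed.

Section local_separability.
Context {R : realType}.

(** The points of [w] may lie outside A, so that the property passes to subsets. *)
Definition seq_dense (Y : metricPType R) (A : set Y) (w : nat -> Y) :=
  forall y (e : R), A y -> 0 < e -> exists n, mdist (w n) y < e.

Lemma seq_dense_sub (Y : metricPType R) (A B : set Y) w :
  A `<=` B -> seq_dense B w -> seq_dense A w.
Proof. by move=> AB wB y e /AB; exact: wB. Qed.

(** The dense sequence of Z may miss the image of V. For each n and k a point of V whose image is 1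
    / (k + 1)-close to [u n] is chosen, if there is one. *)
Lemma seq_dense_isometry (Y Z : metricPType R) (f : Y -> Z) (V : set Y) :
  separable_space Z -> isometry_on V f -> exists w, seq_dense V w.
Proof.
move=> /dense_seqP[u du] iV.
pose P (j : nat) (v : Y) := let: (n, k) := odflt (0, 0)%N (unpickle j) in
  V v /\ mdist (u n) (f v) < k.+1%:R^-1.
exists (fun j => xget point [set v | P j v]) => y e Vy e0.
have [k ke] := natSinv_lt (divr_gt0 e0 (ltr0Sn R 1)).
have [n un] := du (f y) _ (natSinv_gt0 R k).
pose j := pickle (n, k).
have Py : P j y by rewrite /P /j pickleK.
exists j; set v := xget _ _.
have [Vv uv] : V v /\ mdist (u n) (f v) < k.+1%:R^-1.
  have : P j v by apply: (@xgetPex _ point [set v | P j v]); exists y.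
  by rewrite /P /j pickleK.
rewrite -(iV _ _ Vv Vy); have := mdistD (f v) (u n) (f y).
move: un uv ke; rewrite (mdistC (f v) (u n)); move: (k.+1%:R^-1) => k1; lra.
Qed.

(* The points obtained from a base point by following the dense sequences of
   balls around points already obtained have a clopen closure. *)
Lemma connected_seq_dense (Y : metricPType R) : connected [set: Y] ->
  (forall b : Y, exists (r : R) w, 0 < r /\ seq_dense (ball b r) w) ->
  exists w, seq_dense [set: Y] w.
Proof.
move=> cY loc.
have [W WP] : {W : Y * nat -> nat -> Y & forall ak : Y * nat,
    (exists w, seq_dense (ball ak.1 (ak.2.+1%:R^-1 : R)) w) ->
    seq_dense (ball ak.1 (ak.2.+1%:R^-1 : R)) (W ak)}.
  apply: (@choice _ _ (fun (ak : Y * nat) w' =>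
    (exists w, seq_dense (ball ak.1 (ak.2.+1%:R^-1 : R)) w) ->
    seq_dense (ball ak.1 (ak.2.+1%:R^-1 : R)) w')) => ak.
  have [[w hw]|nw] := pselect (exists w, seq_dense (ball ak.1 (ak.2.+1%:R^-1 : R)) w).
    by exists w.
  by exists (fun=> point).
(* A list of pairs encodes a route from the base point: k gives the radius of the next ball and n
   the rank in its dense sequence. There are countably many lists. *)
pose pt := fix pt (l : seq (nat * nat)) : Y :=
  if l is (k, n) :: l' then W (pt l', k) n else point.
pose C := [set y : Y | forall e : R, 0 < e -> exists l, mdist (pt l) y < e].
suff CT : C = setT.
  exists (fun j => pt (odflt [::] (unpickle j))) => y e _ e0.
  have [l hl] : exists l, mdist (pt l) y < e.
    by have : C y by [rewrite CT]; apply.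
  by exists (pickle l); rewrite pickleK.
apply: cY.
- by exists point => e e0; exists [::]; rewrite mdist0.
- exists C; last by rewrite setTI.
  rewrite openE => b Cb; have [r [w [r0 wr]]] := loc b.
  have [k kr] := natSinv_lt (divr_gt0 r0 (ltr0Sn R 1)).
  have k0 := natSinv_gt0 R k.
  have [l lb] := Cb _ (divr_gt0 k0 (ltr0Sn R 1)).
  have sub : ball (pt l) (k.+1%:R^-1 : R) `<=` ball b r.
    move=> y; rewrite !ball_mdist /= => ly; have := mdistD b (pt l) y.
    by rewrite (mdistC b (pt l)); move: k0 ly lb kr; move: (k.+1%:R^-1) => k1; lra.
  have dW : seq_dense (ball (pt l) (k.+1%:R^-1 : R)) (W (pt l, k)).
    by apply: (WP (pt l, k)); exists w; exact: seq_dense_sub wr.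
  apply/nbhs_mdistP; exists (k.+1%:R^-1 / 2); first by rewrite divr_gt0.
  move=> y by_ e e0.
  have [|n hn] := dW y e _ e0; last by exists ((k, n) :: l).
  rewrite ball_mdist /=; have := mdistD (pt l) b y.
  by move: by_ lb; move: (k.+1%:R^-1) => k1; lra.
- exists C; last by rewrite setTI.
  rewrite closure_id; apply/seteqP; split; first exact: subset_closure.
  move=> y cy e e0; have e20 := divr_gt0 e0 (ltr0Sn R 1).
  have [x [Cx]] := cy _ (nbhsx_ballx y (e / 2) e20).
  rewrite ball_mdist /= => yx; have [l hl] := Cx _ e20; exists l.
  have := mdistD (pt l) x y; rewrite (mdistC x y); lra.
Qed.

End local_separability.

Lemma continuous_borel (R : realType) (Y Z : metricPType R) (h : Y -> Z) :
  continuous h -> measurable_fun [set: borel Y] (h : borel Y -> borel Z).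
Proof.
move=> ch _ A mA; rewrite setTI.
pose G : set (set Z) := [set A | @measurable _ (borel Y) (h @^-1` A)].
have : (@measurable _ (borel Z)) `<=` G; last exact.
apply: smallest_sub; last first.
  by move=> O oO; apply: borel_open; apply: open_comp => // x _; exact: ch.
split.
- by rewrite /G /= preimage_set0.
- by move=> B GB; rewrite /G /= setTD preimage_setC; exact: measurableC.
- by move=> B GB; rewrite /G /= preimage_bigcup; apply: bigcup_measurable => i _; exact: GB.
Qed.

(** * Deck transformations and the lifted measure *)

Section lift_measure.
Context {R : realType} {Y Z : metricPType R} (f : Y -> Z).
Variables (m : {measure set (borel Z) -> \bar R}) (mY : {measure set (borel Y) -> \bar R}).
Hypotheses (sep_Z : separable_space Z) (geo_Z : geodesic_space Z).
Hypotheses (cov_f : normal_covering f) (lift_f : is_lift f m mY).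

Let lift_d : is_lift_dist f. Proof. by have [] := lift_f. Qed.
Let cov : covering_map f. Proof. by have [] := cov_f. Qed.
Let contf : continuous f. Proof. by have [] := cov. Qed.

(** Small balls of Y are isometric to subsets of the separable Z, so the connected Y is separable;
    balls of radii 1 / (k + 1) around a dense sequence then suffice. *)
Lemma isometric_cover : exists V : nat -> set Y,
  (forall i, open (V i) /\ isometry_on (V i) f) /\ \bigcup_i V i = setT.
Proof.
have iso b : exists (r : R), 0 < r /\ isometry_on (ball b r) f.
  have [V [oV Vb iV]] := isometric_nbhd lift_d geo_Z cov b.
  have /nbhs_mdistP[r r0 rV] : nbhs b V by exact: open_nbhs_nbhs.
  by exists r; split => // x y; rewrite ball_mdist => /rV Vx /rV Vy; exact: iV.
have conY : connected [set: Y] by have [] := lift_f.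
have [w dw] : exists w, seq_dense [set: Y] w.
  apply: connected_seq_dense conY _ => b; have [r [r0 ir]] := iso b.
  by have [w dw] := seq_dense_isometry sep_Z ir; exists r, w.
pose B (j : nat) : set Y := let: (n, k) := odflt (0, 0)%N (unpickle j) in
  ball (w n) (k.+1%:R^-1 : R).
exists (fun j => if `[< isometry_on (B j) f >] then B j else set0); split.
  move=> j; case: ifPn => [/asboolP iB|_]; last by split; [exact: open0|move=> x y []].
  by split => //; rewrite /B; case: (odflt _ _) => n k; exact: open_ball_metric.
rewrite -subTset => y _; have [r [r0 ir]] := iso y.
have [k kr] := natSinv_lt (divr_gt0 r0 (ltr0Sn R 1)).
have [n hn] := dw y _ I (natSinv_gt0 R k).
have BE : B (pickle (n, k)) = ball (w n) (k.+1%:R^-1 : R) by rewrite /B pickleK.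
exists (pickle (n, k)) => //; rewrite BE ifT; first by rewrite ball_mdist.
apply/asboolP => x x'; rewrite !ball_mdist /= => wx wx'.
have sub z : mdist (w n) z < k.+1%:R^-1 -> ball y r z.
  rewrite ball_mdist /= => wz; have := mdistD y (w n) z; rewrite (mdistC y (w n)).
  by move: hn wz kr; move: (k.+1%:R^-1) => k1; lra.
by apply: ir; exact: sub.
Qed.

Lemma covering_open (O : set Y) : open O -> open (f @` O).
Proof.
move=> oO; rewrite openE => _ [a Oa <-].
have /nbhs_mdistP[e e0 eO] : nbhs a O by exact: open_nbhs_nbhs.
apply/nbhs_mdistP; exists e => // y ay.
have [b fb ab] := lift_point lift_d geo_Z cov a y.
by exists b => //; apply: eO; exact: le_lt_trans ay.
Qed.

Lemma isometry_on_inj (V : set Y) a b : isometry_on V f -> V a -> V b -> f a = f b -> a = b.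
Proof. by move=> iV Va Vb fab; apply: mdist_positivity; rewrite -(iV _ _ Va Vb) fab mdist0. Qed.

(** Uniqueness of lifts: the set where g and h agree is closed, and open because f is injective near
    each point. *)
Lemma deck_eq (g h : Y -> Y) (a : Y) : deck f g -> deck f h -> g a = h a -> g = h.
Proof.
move=> /deckP[_ [cg _ _ _ [fg _]]] /deckP[_ [ch _ _ _ [fh _]]] gha.
have conY : connected [set: Y] by have [] := lift_f.
suff : [set b | g b = h b] = setT.
  by move=> E; apply/funext => b; have : [set: Y] b by []; rewrite -E.
apply: conY; first by exists a.
- exists [set b | g b = h b]; last by rewrite setTI.
  rewrite openE => b /= ghb.
  have [V [oV Vb iV]] := isometric_nbhd lift_d geo_Z cov (g b).
  have ng : nbhs b (g @^-1` V) by apply: cg; exact: open_nbhs_nbhs.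
  have nh : nbhs b (h @^-1` V) by apply: ch; rewrite -ghb; exact: open_nbhs_nbhs.
  apply: filterS (filterI ng nh) => c [/= gc hc].
  apply: (isometry_on_inj iV gc hc).
  by rewrite -[LHS]/((f \o g) c) fg -[RHS]/((f \o h) c) fh.
- exists [set b | g b = h b]; last by rewrite setTI.
  rewrite closure_id; apply/seteqP; split; first exact: subset_closure.
  move=> b cb; apply: mdist_positivity; apply/eqP; rewrite eq_le mdist_ge0 andbT.
  apply/ler_addgt0Pr => e e0; rewrite add0r.
  have e20 := divr_gt0 e0 (ltr0Sn R 1).
  have ng : nbhs b (g @^-1` ball (g b) (e / 2)) by apply: cg; exact: nbhsx_ballx.
  have nh : nbhs b (h @^-1` ball (h b) (e / 2)) by apply: ch; exact: nbhsx_ballx.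
  have [c [/= ghc [/=]]] := cb _ (filterI ng nh).
  rewrite !ball_mdist /= ghc => h1 h2.
  have := mdistD (g b) (h c) (h b); rewrite (mdistC (h c)); lra.
Qed.

Lemma deck_image_measurable (g : Y -> Y) (E : set (borel Y)) :
  deck f g -> measurable E -> @measurable _ (borel Y) (g @` E).
Proof.
move=> /deckP[h [cg ch gh hg _]] mE.
have -> : g @` E = (h : borel Y -> borel Y) @^-1` E.
  by apply/seteqP; split => [_ [a Ea <-]|b Eb] /=; [rewrite gh|exists (h b) => //; rewrite hg].
rewrite -[X in measurable X]setTI.
have mh : measurable_fun [set: borel Y] (h : borel Y -> borel Y).
  exact: continuous_borel.
exact: mh.
Qed.

(* F is a Borel fundamental domain of the deck group in the ball around y0. *)
Lemma ball_section (y0 : Y) (r : R) : 0 < r ->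
  exists F : set (borel Y), [/\ F `<=` ball y0 r,
    (forall z, mdist (f y0) z < r -> exists2 a, F a & f a = z),
    (forall a b, F a -> F b -> f a = f b -> a = b) &
    forall g, deck f g -> @measurable _ (borel Y) (g @` F) /\
      mY (g @` F) = m (ball (f y0) r)].
Proof.
move=> r0; have [V [VP VT]] := isometric_cover.
pose B i := V i `&` ball y0 r.
have oB i : open (B i) by apply: openI; [exact: (VP i).1|exact: open_ball_metric].
(* The sets are made disjoint in Z and not in Y: each point of the ball is assigned to the first
   [B i] whose image contains it, which leaves a single preimage. *)
pose D := seqDU (fun i => f @` B i : set (borel Z)).
have fBE : \bigcup_i D i = ball (f y0) r.
  rewrite -seqDU_bigcup_eq; apply/seteqP; split.
    move=> z [i _ [a [_ ya] <-]]; move: ya; rewrite !ball_mdist /= => ya.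
    by rewrite (le_lt_trans _ ya)// lift_dist_ge.
  move=> z; rewrite ball_mdist /= => yz.
  have [b fb yb] := lift_point lift_d geo_Z cov y0 z.
  have [i _ Vb] : (\bigcup_i V i) b by rewrite VT.
  exists i => //; exists b => //; split => //; rewrite ball_mdist /=.
  exact: le_lt_trans yz.
have tD : trivIset setT D := @trivIset_seqDU _ _.
have mD i : measurable (D i).
  have mB j : @measurable _ (borel Z) (f @` B j) by apply: borel_open; exact: covering_open.
  by apply: measurableD => //; exact: bigsetU_measurable.
pose F i : set (borel Y) := B i `&` f @^-1` (D i).
have mF i : measurable (F i).
  apply: measurableI; first exact: borel_open.
  have mf : measurable_fun [set: borel Y] (f : borel Y -> borel Z).
    exact: continuous_borel contf.
  by rewrite -[X in measurable X]setTI; exact: mf.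
have fF i : f @` F i = D i.
  apply/seteqP; split => [_ [a [_ Da] <-]//|z Dz].
  by have [[a Ba az] _] := Dz; exists a => //; split => //=; rewrite az.
have idx i j z : D i z -> D j z -> i = j.
  by move=> Di Dj; apply: (tD i j I I); exists z.
exists (\bigcup_i F i); split.
- by move=> a [i _ [[]]].
- move=> z yz; have : (\bigcup_i D i) z by rewrite fBE ball_mdist.
  by move=> [i _]; rewrite -fF => -[a Fa <-]; exists a => //; exists i.
- move=> a b [i _ [[Va _] Da]] [j _ [[Vb _] Db]] fab.
  have ij : i = j by apply: (idx _ _ (f a)) => //; rewrite fab.
  by subst j; exact: (isometry_on_inj (VP i).2).
move=> g dg; have [h [cg ch gh hg [fg fh]]] := deckP dg.
have mgF i : @measurable _ (borel Y) (g @` F i) by exact: deck_image_measurable.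
rewrite image_bigcup; split; first exact: bigcupT_measurable.
have fgF i : f @` (g @` F i) = D i.
  by rewrite image_comp fg.
rewrite measure_semi_bigcup//; last 2 first.
- move=> i j _ _ [b [[a Fa ab] [c Fc cb]]]; apply: (idx _ _ (f b)).
  + by rewrite -fgF; exists b => //; exists a.
  + by rewrite -fgF; exists b => //; exists c.
- exact: bigcupT_measurable.
rewrite -fBE measure_semi_bigcup//; last exact: bigcupT_measurable.
apply: eq_eseriesr => i _; rewrite -fgF.
have [_ _ lift_m] := lift_f; apply: (lift_m (g @` V i)) => //.
- rewrite (_ : g @` V i = h @^-1` V i).
    by apply: open_comp; [move=> x _; exact: ch|exact: (VP i).1].
  by apply/seteqP; split => [_ [a Va <-]|b Vb] /=; [rewrite gh|exists (h b) => //; rewrite hg].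
- move=> _ _ [a Va <-] [b Vb <-]; rewrite (deck_isometry lift_d dg).
  by rewrite -[f (g a)]/((f \o g) a) -[f (g b)]/((f \o g) b) fg (VP i).2.
- by move=> _ [a [[Va _] _] <-]; exists a.
Qed.

End lift_measure.

(** * Counting sets of equal measure *)

Section counting_bounds.
Local Open Scope ereal_scope.
Context d {T : measurableType d} {R : realType} (mu : {measure set T -> \bar R}).
Context {I : choiceType}.
Variables (D : set I) (F : I -> set T) (A : set T) (c : \bar R).
Hypotheses (mF : forall i, D i -> measurable (F i)) (mA : measurable A).
Hypotheses (muF : forall i, D i -> mu (F i) = c) (c0 : 0 < c).

Let sum_const (B : {fset I}) : [set` B] `<=` D ->
  \sum_(i \in [set` B]) mu (F i) = (#|` B|)%:R%:E * c.
Proof.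
move=> BD; rewrite (@eq_fsbigr _ _ _ _ _ (fun=> c)); last first.
  by move=> i; rewrite inE => /BD; exact: muF.
rewrite fsbig_finite//= set_fsetK big_const_seq count_predT iter_addr_0.
by rewrite mule_natl.
Qed.

Lemma measure_le_counting : A `<=` \bigcup_(i in D) F i -> mu A <= counting D * c.
Proof.
move=> AD; rewrite /counting; case: ifPn => [/asboolP finD|_]; last by rewrite gt0_mulye// leey.
apply: le_trans (content_sub_fsum _ finD mF mA AD) _.
by rewrite -{1}(fset_setK finD) sum_const// fset_setK.
Qed.

(** The index set may be infinite of any cardinality, so only finite subfamilies are summed; as c >
    0, their total measure is unbounded when D is infinite. *)
Lemma counting_le_measure : trivIset D F -> (forall i, D i -> F i `<=` A) ->
  counting D * c <= mu A.
Proof.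
move=> tF FA.
have fset_le (B : {fset I}) : [set` B] `<=` D -> (#|` B|)%:R%:E * c <= mu A.
  move=> BD; rewrite -sum_const// -measure_fin_bigcup//; last 2 first.
  - exact: sub_trivIset tF.
  - by move=> i /BD; exact: mF.
  apply: le_measure; rewrite ?inE//.
    by apply: fin_bigcup_measurable => // i /BD; exact: mF.
  by apply: bigcup_sub => i /BD; exact: FA.
rewrite /counting; case: ifPn => [/asboolP finD|/asboolP infD].
  by apply: fset_le; rewrite fset_setK.
rewrite gt0_mulye// leye_eq; apply/eqP/eq_infty => t.
have [c1 c10 c1c] : exists2 c1 : R, (0 < c1)%R & c1%:E <= c.
  move: c0; case: (c) => [s| |]//; first by rewrite lte_fin; exists s.
  by move=> _; exists 1%R => //; rewrite leey.
have [B BD nB] := infinite_set_fset (Num.truncn (`|t| / c1)).+1 infD.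
apply: le_trans (fset_le B BD).
apply: (@le_trans _ _ ((#|` B|)%:R%:E * c1%:E)); last by rewrite lee_wpmul2l// lee_fin.
rewrite -EFinM lee_fin (le_trans (ler_norm t))// -ler_pdivrMr//.
apply: le_trans (ltW (truncnS_gt _)) _.
by rewrite ler_nat.
Qed.

End counting_bounds.

Theorem theorem4 (R : realType) (K N : R) (N_ge1 : 1 <= N)
    (X : metricPType R) (m : {measure set (borel X) -> \bar R})
    (X_nonbranching : nonbranching X) (X_CDstar : CDstar K N m)
    (supp_m : measure_support m = [set: X]) :
  (forall p q : X, p <> q -> m [set x : X | mdist p x = mdist q x] = 0%E) /\
  (forall (Xbar : metricPType R) (mbar : {measure set (borel Xbar) -> \bar R})
      (prj : Xbar -> X) (xbar0 : Xbar) (x0 : X),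
    normal_covering prj -> is_lift prj m mbar -> prj xbar0 = x0 ->
    forall r : R, 0 < r ->
      (mbar (ball xbar0 r)
        <= counting (deck_ball prj xbar0 (2 * r)) * m (ball x0 r))%E /\
      (counting (deck_ball prj xbar0 r) * m (ball x0 r)
        <= mbar (ball xbar0 (2 * r)))%E).
Proof.
split; first exact: bisector_null X_CDstar supp_m.
move=> Y mY f y0 x0 norm_f lift_f <- r r0.
have [_ sep_X _ _] := X_CDstar; have geo_X := X_nonbranching.1.
have [_ lift_d _] := lift_f.
have [F [FB Fsurj Finj gF]] := ball_section sep_X geo_X norm_f lift_f y0 r0.
(* Positivity gives an infinite count times this measure the value +oo. *)
have c0 : (0 < m (ball (f y0) r))%E.
  have : measure_support m (f y0) by rewrite supp_m.
  by apply; [exact: open_ball_metric|exact: ballxx].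
have mB s : @measurable _ (borel Y) (ball y0 s) by apply: borel_open; exact: open_ball_metric.
split.
- apply: (@measure_le_counting _ _ _ mY _ (deck_ball f y0 (2 * r)) (fun g => g @` F)) => //.
  + by move=> g [/gF[]].
  + by move=> g [/gF[]].
  move=> a; rewrite ball_mdist /= => ya.
  have [b Fb fba] : exists2 b, F b & f b = f a.
    by apply: Fsurj; rewrite (le_lt_trans _ ya)// lift_dist_ge.
  (* Normality moves the point b of F above f a to a itself; then g y0 is as far from a as y0 is
     from b, whence the radius 2 r. *)
  have [g dg gba] := norm_f.2 _ _ fba.
  exists g; last by exists b.
  split => //; have := FB b Fb; rewrite ball_mdist /= => yb.
  have := mdistD y0 a (g y0); rewrite -{2}gba (deck_isometry lift_d dg) (mdistC b); lra.
- apply: (@counting_le_measure _ _ _ mY _ (deck_ball f y0 r) (fun g => g @` F)) => //.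
  + by move=> g [/gF[]].
  + by move=> g [/gF[]].
  + move=> g h [dg _] [dh _] [_ [[a Fa <-] [b Fb hbga]]].
    have [_ [_ _ _ _ [fg _]]] := deckP dg; have [_ [_ _ _ _ [fh _]]] := deckP dh.
    have ba : b = a.
      by apply: Finj => //; rewrite -[in LHS]fh -[in RHS]fg /= hbga.
    apply: (deck_eq geo_X norm_f lift_f dg dh (a := a)).
    by rewrite -hbga ba.
  + move=> g [dg yg] _ [a Fa <-]; have := FB a Fa; rewrite !ball_mdist /= => ya.
    have := mdistD y0 (g y0) (g a); rewrite (deck_isometry lift_d dg); lra.
Qed.
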